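(* For every integer $d>9$, the diameter of the graph ($1$-skeleton) of the $d$-dimensional associahedron is $2d-4$. Equivalently, for every integer $n>12$, the maximum flip distance between two triangulations of a convex polygon with $n$ vertices is $2n-10$.
   Context: Let $\pi$ be a convex polygon with $n$ vertices. An edge on $\pi$ is a set of two distinct vertices of $\pi$; two edges are crossing if they are disjoint but their convex hulls intersect. An edge is interior if it crosses some edge on $\pi$, and a boundary edge otherwise. A triangulation of $\pi$ is an inclusion-maximal set of pairwise non-crossing edges on $\pi$. If $\varepsilon$ is an interior edge of a triangulation $T$, it is a diagonal of a unique quadrilateral whose four boundary edges belong to $T$; replacing $\varepsilon$ in $T$ by the other diagonal of this quadrilateral is called a flip. The flip graph of $\pi$ has the triangulations of $\pi$ as vertices, two being adjacent when they differ by a flip; the flip distance of two triangulations is their distance in this graph. Let $\Sigma_{n}$ be the abstract simplicial complex whose faces are the sets of pairwise non-crossing interior edges on a convex polygon with $n$ vertices. The $d$-dimensional associahedron is any $d$-dimensional polytope whose boundary complex is isomorphic to $\Sigma_{d+3}$; its $1$-skeleton is isomorphic to the flip graph of a convex polygon with $d+3$ vertices.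
   Formalization: The associahedron is taken to be a d-dimensional polytope whose polar has boundary complex isomorphic to Σ_{d+3} (its face poset is anti-isomorphic to Σ_{d+3}); if its own boundary complex were Σ_{d+3}, its graph would not be the flip graph and the claim would fail. *)

(* Defs.v *)
From HB Require Import structures.
From mathcomp Require Import all_boot all_order all_algebra.
From mathcomp Require Import boolp classical_sets cardinality reals.

Set Implicit Arguments.
Unset Strict Implicit.
Unset Printing Implicit Defensive.

Import Order.TTheory GRing.Theory Num.Theory.

Local Open Scope classical_set_scope.
Local Open Scope ring_scope.

Section Graphs.
Variables (T : Type) (V : set T) (adj : T -> T -> Prop).

Fixpoint walk (k : nat) (x y : T) : Prop :=
  if k is k'.+1 then exists2 z, adj x z & walk k' z y else x = y.

Definition graph_dist (x y : T) (k : nat) : Prop :=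
  walk k x y /\ forall j, walk j x y -> (k <= j)%N.

(* In particular, the graph is nonempty and connected. *)
Definition graph_diameter (D : nat) : Prop :=
  (forall x y, V x -> V y -> exists2 k, graph_dist x y k & (k <= D)%N) /\
  (exists x y, [/\ V x, V y & graph_dist x y D]).

End Graphs.

Definition conv_hull (R : realType) (E : lmodType R) (A : set E) : set E :=
  [set x | exists k (p : 'I_k -> E) (w : 'I_k -> R),
     [/\ forall i, A (p i), forall i, 0 <= w i,
         \sum_i w i = 1 & x = \sum_i w i *: p i]].

Section Polygon.
Variables (R : realType) (n : nat) (v : 'I_n -> 'rV[R]_2).

(* The v i are the vertices of a convex polygon: no v i is in the convex hull
   of the others. They need not be listed in cyclic order. *)
Definition convex_polygon : Prop :=
  (2 < n)%N /\ forall i, ~ conv_hull (v @` [set j | j <> i]) (v i).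

(* An edge is represented by the set of the labels of its two vertices. *)
Definition is_edge (e : {set 'I_n}) : Prop := #|e| = 2%N.

Definition crossing (e f : {set 'I_n}) : Prop :=
  [/\ is_edge e, is_edge f, (e :&: f)%SET = finset.set0 &
      conv_hull (v @` [set` e]) `&` conv_hull (v @` [set` f]) !=set0].

Definition interior_edge (e : {set 'I_n}) : Prop :=
  is_edge e /\ exists f, crossing e f.

Definition noncrossing_edges (A : {set {set 'I_n}}) : Prop :=
  (forall e, e \in A -> is_edge e) /\
  (forall e f, e \in A -> f \in A -> ~ crossing e f).

Definition triangulation (T : {set {set 'I_n}}) : Prop :=
  noncrossing_edges T /\
  forall A, noncrossing_edges A -> T \subset A -> A = T.

(* a, b, c, d are, in this cyclic order, the vertices of the quadrilateral;
   the crossing condition says that ac and bd are its diagonals. *)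
Definition flip (T T' : {set {set 'I_n}}) : Prop :=
  exists a b c d : 'I_n,
    let ac := [set a; c]%SET in let bd := [set b; d]%SET in
    [/\ ac \in T, interior_edge ac, crossing ac bd,
        [/\ [set a; b]%SET \in T, [set b; c]%SET \in T,
            [set c; d]%SET \in T & [set d; a]%SET \in T] &
        T' = (bd |: (T :\ ac))%SET].

Definition flip_adj (T T' : {set {set 'I_n}}) : Prop :=
  [/\ triangulation T, triangulation T' & flip T T'].

(* The faces of the complex Sigma_n, including the empty one. *)
Definition Sigma_face (A : {set {set 'I_n}}) : Prop :=
  (forall e, e \in A -> interior_edge e) /\
  (forall e f, e \in A -> f \in A -> ~ crossing e f).

End Polygon.

Section Polytope.
Variables (R : realType) (m : nat) (P : set 'rV[R]_m).

Definition polytope : Prop :=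
  exists2 A : set 'rV[R]_m, finite_set A & P = conv_hull A.

(* U is the linear span of P - x0, i.e., the direction of the affine hull. *)
Definition has_dim (d : nat) : Prop :=
  exists (x0 : 'rV[R]_m) (U : {vspace 'rV[R]_m}),
    [/\ P x0, \dim U = d, forall x, P x -> x - x0 \in U &
        forall W : {vspace 'rV[R]_m},
          (forall x, P x -> x - x0 \in W) -> (U <= W)%VS].

(* Intersections with supporting hyperplanes; c = 0, b = 0 gives P itself. *)
Definition nonempty_face (F : set 'rV[R]_m) : Prop :=
  F !=set0 /\
  exists (c : 'cV[R]_m) (b : R),
    (forall x, P x -> (x *m c) 0 0 <= b) /\
    F = [set x | P x /\ (x *m c) 0 0 = b].

Definition polytope_vertex (x : 'rV[R]_m) : Prop := nonempty_face [set x].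

Definition polytope_adj (x y : 'rV[R]_m) : Prop :=
  [/\ polytope_vertex x, polytope_vertex y, x <> y &
      nonempty_face (conv_hull [set x; y])].

(* Sigma_(d+3) is the boundary complex of the polar of P: inclusion-reversing
   bijection between its faces and the nonempty faces of P (the empty face
   corresponds to P itself, the triangulations to the vertices of P). *)
Definition associahedron (d : nat) : Prop :=
  [/\ polytope, has_dim d &
      exists (v : 'I_(d + 3) -> 'rV[R]_2)
             (phi : {set {set 'I_(d + 3)}} -> set 'rV[R]_m),
        [/\ convex_polygon v,
            forall A, Sigma_face v A -> nonempty_face (phi A),
            forall F, nonempty_face F -> exists2 A, Sigma_face v A & phi A = F &
            forall A B, Sigma_face v A -> Sigma_face v B ->
              (phi A `<=` phi B <-> B \subset A)]].

End Polytope.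

(* Main.v *)
Require Import Defs.
From mathcomp Require Import all_boot all_order all_algebra zify ring lra.
From mathcomp Require Import boolp classical_sets cardinality reals.

(** Upper bound: a vertex of interior degree [k] in a triangulation can be joined
    to all other vertices by [n - 3 - k] flips.  The interior degrees of two
    triangulations add up to [4n - 12 > 3n] over all vertices, so some vertex has
    total degree at least [4], and [2(n - 3) - 4] flips through its fan suffice.

    Lower bound, by linear programming duality: let [w] be an alternating
    function of three vertices whose coboundary on every four vertices is at most
    [1] in absolute value.  A flip replaces the triangles [abc], [acd] by [abd],
    [bcd], so it changes the sum of [w] over the positively oriented triangles of
    a triangulation by at most [1].  For the pair of zigzag triangulations [U],
    [V] used here, the sphere obtained by gluing [U] to [V] is a capped
    triangulated tube: the vertices can be numbered [0, ..., n - 1] so that, away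
    from the ends, two are adjacent when they differ by 2, 5 or 7.  There is a
    translation-invariant [w], depending only on the two gaps of the sorted triple
    and on gaps above [10] as if they were [10], for which the sums on [U] and
    [V] differ by [2n - 10]; the coboundary bound is then a finite computation.

    The graph of the associahedron is handled through its face lattice: minimal
    faces are vertices, and a face whose only proper faces are two vertices is
    the segment joining them. *)

Set Implicit Arguments.
Unset Strict Implicit.
Unset Printing Implicit Defensive.

Import Order.TTheory GRing.Theory Num.Theory.

(** * The weight cocycle *)

Section Weights.
Local Open Scope ring_scope.

(* [4 * w(p, q)] for gaps [p < q <= 10], where [w(p, q)] is the weight of a triple
   of tube positions [x < x + p < x + p + q]; the missing entries follow from
   [w(q, p) = - w(p, q)], and larger gaps count as [10].  The values are a
   solution of the linear program dual to filling the sphere with tetrahedra. *)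
Definition weight_table : seq (seq int) :=
  [:: [:: -2; 0; 0; 0; 0; -2; 0; -2; -1];
      [:: 2; 0; 4; 2; 2; 2; 1; 2];
      [:: -2; 0; 0; -2; -1; -2; -1];
      [:: 2; 0; 1; 0; 0; 0];
      [:: -1; -2; -1; -2; -1];
      [:: -1; 0; -1; 0];
      [:: 1; 0; 1];
      [:: -1; 0];
      [:: 1]].

Definition capped_weight (p q : nat) : int :=
  if (p < q)%N then nth 0 (nth [::] weight_table p.-1) (q - p).-1
  else if (q < p)%N then - nth 0 (nth [::] weight_table q.-1) (p - q).-1
  else 0.

Definition gap_weight (p q : nat) : int := capped_weight (minn p 10) (minn q 10).

(** The simplicial coboundary of the weight on four positions with consecutive gaps [p], [q],
    [r]. *)
Definition weight_coboundary (p q r : nat) : int :=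
  gap_weight q r - gap_weight (p + q) r + gap_weight p (q + r) - gap_weight p q.

Lemma weight_coboundary_capped :
  all (fun p => all (fun q => all (fun r => `|weight_coboundary p q r| <= 4)
    (iota 1 10)) (iota 1 10)) (iota 1 10).
Proof. by vm_compute. Qed.

Lemma weight_coboundary_le4 p q r : (0 < p)%N -> (0 < q)%N -> (0 < r)%N ->
  `|weight_coboundary p q r| <= 4.
Proof.
move=> p0 q0 r0.
(* Capping at [10] is compatible with adding gaps, so the [1000] triples of gaps at most [10]
   represent all triples. *)
have -> : weight_coboundary p q r =
          weight_coboundary (minn p 10) (minn q 10) (minn r 10).
  have cap a b : minn (a + b) 10 = minn (minn a 10 + minn b 10) 10 by lia.
  have capK a : minn (minn a 10) 10 = minn a 10 by lia.
  by rewrite /weight_coboundary /gap_weight (cap p q) (cap q r) !capK.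
have := weight_coboundary_capped.
move=> /allP/(_ (minn p 10)); rewrite mem_iota => /(_ ltac:(lia)).
move=> /allP/(_ (minn q 10)); rewrite mem_iota => /(_ ltac:(lia)).
by move=> /allP/(_ (minn r 10)); rewrite mem_iota => /(_ ltac:(lia)).
Qed.

(** The alternating extension of [gap_weight] to distinct positions: each branch sorts the triple
    and carries the sign of the sorting permutation. *)
Definition alt_weight (a b c : nat) : int :=
  if (a < b)%N then
    if (b < c)%N then gap_weight (b - a) (c - b)
    else if (a < c)%N then - gap_weight (c - a) (b - c)
    else gap_weight (a - c) (b - a)
  else
    if (a < c)%N then - gap_weight (a - b) (c - a)
    else if (b < c)%N then gap_weight (c - b) (a - c)
    else - gap_weight (b - c) (a - b).

(** The coboundary of an alternating function is alternating, so its absolute value can be computed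
    on the sorted quadruple. *)
Lemma alt_weight_coboundary_le4 a b c d :
  uniq [:: a; b; c; d] ->
  `|alt_weight b c d - alt_weight a c d + alt_weight a b d - alt_weight a b c|
    <= 4.
Proof.
rewrite /= !inE !negb_or -!andbA => /and5P[ab ac ad bc /and3P[bd cd _]].
have sorted4 x y z t : (x < y)%N -> (y < z)%N -> (z < t)%N ->
    `|gap_weight (z - y) (t - z) - gap_weight (z - x) (t - z)
      + gap_weight (y - x) (t - y) - gap_weight (y - x) (z - y)| <= 4.
  move=> xy yz zt.
  have := @weight_coboundary_le4 (y - x) (z - y) (t - z).
  rewrite /weight_coboundary.
  have -> : (y - x + (z - y) = z - x)%N by lia.
  have -> : (z - y + (t - z) = t - y)%N by lia.
  by apply; lia.
rewrite /alt_weight.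
case: (ltngtP a b) ab => // ab _; case: (ltngtP a c) ac => // ac _;
case: (ltngtP a d) ad => // ad _; case: (ltngtP b c) bc => // bc _;
case: (ltngtP b d) bd => // bd _; case: (ltngtP c d) cd => // cd _;
try (exfalso; lia);
match goal with
| H1 : is_true (?x < ?y)%N, H2 : is_true (?y < ?z)%N,
  H3 : is_true (?z < ?t)%N |- _ =>
  have := sorted4 x y z t H1 H2 H3
end; clear; lia.
Qed.

End Weights.

(** * Chords of a polygon as relations on ranks *)

Section ChordRelations.
Local Open Scope nat_scope.
Variable n : nat.
Implicit Types (E : rel nat) (W : nat -> nat -> nat -> int).

Definition chords_nc E := forall i j k l,
  i < j -> j < k -> k < l -> l < n -> E i k -> E j l -> False.

(** Together with the chord from [0] to [n - 1], this recursive description of a triangulation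
    replaces maximality. *)
Definition chords_split E := forall i j, i.+1 < j -> j < n -> E i j ->
  exists k, [/\ i < k, k < j, E i k & E k j].

(** Descend from the top chord through the triangles, keeping a chord of [E] that spans [x] and [y],
    until an apex falls strictly between them. *)
Lemma chords_split_maximal E x y : chords_split E -> E 0 n.-1 ->
  x < y -> y < n -> ~~ E x y ->
  exists a b, [/\ a < b, b < n, E a b &
    (a < x < b) && (b < y) || (x < a < y) && (y < b)].
Proof.
move=> spE Etop xy yn nExy.
suff H d : forall a b, b - a <= d -> a <= x -> y <= b -> b < n -> E a b ->
    exists a b, [/\ a < b, b < n, E a b &
    (a < x < b) && (b < y) || (x < a < y) && (y < b)].
  by apply: (H n 0 n.-1) => //; lia.
elim: d => [|d IHd] a b dab ax yb bn Eab; first by exfalso; lia.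
have [e|ne] := eqVneq (a, b) (x, y).
  by case: e Eab nExy => -> -> ->.
have {}ne : a < x \/ y < b.
  case: (ltngtP a x) ax ne => // [|->]; first by left.
  by case: (ltngtP y b) yb => // [|->]; [right|rewrite eqxx].
have [c [ac cb Eac Ecb]] : exists k, [/\ a < k, k < b, E a k & E k b].
  by apply: spE => //; lia.
have [yc|cy] := leqP y c; first by apply: (IHd a c) => //; lia.
have [cx|xc] := leqP c x; first by apply: (IHd c b) => //; lia.
(* Now [x < c < y]: the chord [ac] crosses [xy] if [a < x], and [cb] crosses it if [y < b]. *)
case: ne => [lax|lyb].
- by exists a, c; split=> //; lia.
- by exists c, b; split=> //; lia.
Qed.

Definition edge_count E i j : nat :=
  \sum_(x < n) \sum_(y < n) [&& i <= x, x < y, y <= j & E x y].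

Lemma sum_pair_eq (a b : nat) : a < n -> b < n ->
  \sum_(x < n) \sum_(y < n) ((x == a :> nat) && (y == b :> nat)) = 1.
Proof.
move=> an bn; rewrite (bigD1 (Ordinal an)) //= (bigD1 (Ordinal bn)) //= !eqxx.
rewrite !big1 // => [x|y]; first by rewrite -val_eqE /= => /negPf ->; rewrite big1.
by rewrite -val_eqE /= => /negPf ->.
Qed.

(** A chord within [[i, j]] that straddles [k] crosses [ik] or [kj], unless it is [ij] itself. *)
Lemma edge_count_split E i k j : chords_nc E -> i < k -> k < j -> j < n ->
  E i k -> E k j -> E i j ->
  edge_count E i j = edge_count E i k + edge_count E k j + 1.
Proof.
move=> nc ik kj jn Eik Ekj Eij.
rewrite -(@sum_pair_eq i j) //; last lia.
rewrite /edge_count -!big_split; apply: eq_bigr => x _ /=.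
rewrite -!big_split; apply: eq_bigr => y _ /=.
case Exy: (E x y); rewrite ?andbT ?andbF.
  have h1 : ~ (i < x < k /\ k < y).
    by move=> [/andP[? ?] ?]; apply: (nc i x k y).
  have h2 : x = i :> nat -> ~ (k < y < j).
    by move=> xi /andP[? ?]; apply: (nc i k y j) => //; rewrite -xi.
  lia.
suff : ((x == i :> nat) && (y == j :> nat)) = false by lia.
by apply/negP => /andP[/eqP xi /eqP yj]; move: Exy; rewrite xi yj Eij.
Qed.

Lemma edge_count_chord E i j : chords_nc E -> chords_split E ->
  i < j -> j < n -> E i j -> (forall k, k.+1 < n -> E k k.+1) ->
  edge_count E i j = 2 * (j - i) - 1.
Proof.
move=> nc sp ij jn Eij bd; have [d] := ubnP (j - i).
elim: d i j ij jn Eij => // d IHd i j ij jn Eij dij.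
have [ji|ji] := eqVneq j i.+1.
  have -> : 2 * (j - i) - 1 = 1 by lia.
  rewrite -(@sum_pair_eq i j) //; last lia.
  apply: eq_bigr => x _; apply: eq_bigr => y _.
  case Exy: (E x y); first by rewrite andbT; lia.
  rewrite !andbF; suff : ((x == i :> nat) && (y == j :> nat)) = false by lia.
  by apply/negP => /andP[/eqP xi /eqP yj]; move: Exy; rewrite xi yj Eij.
have [k [ik kj Eik Ekj]] := sp i j ltac:(lia) jn Eij.
rewrite (edge_count_split nc ik kj) // !IHd //; lia.
Qed.

Local Open Scope ring_scope.

(** * Sums over the triangles of a chord relation *)

Definition triangle_sum E W (i j : nat) : int :=
  \sum_(x < n) \sum_(y < n) \sum_(z < n)
    (if [&& i <= x, x < y, y < z & z <= j]%N && [&& E x y, E y z & E x z]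
     then W x y z else 0).

Lemma sum_triple_eq W (a b c : nat) : (a < n)%N -> (b < n)%N -> (c < n)%N ->
  \sum_(x < n) \sum_(y < n) \sum_(z < n)
    (if [&& x == a :> nat, y == b :> nat & z == c :> nat] then W x y z else 0)
  = W a b c.
Proof.
move=> an bn cn; rewrite (bigD1 (Ordinal an)) //= (bigD1 (Ordinal bn)) //=.
rewrite (bigD1 (Ordinal cn)) //= !eqxx /= !big1 ?addr0 // => [x|y|z];
  rewrite -val_eqE /= => /negPf ->; rewrite ?andbF //=.
  by rewrite big1 // => ? _; rewrite big1.
by rewrite big1.
Qed.

(** Straddling chords are excluded as in the edge count, and a triangle on [ij] with an apex other
    than [k] would have a side crossing [ik] or [kj]. *)
Lemma triangle_sum_split E W i k j : chords_nc E ->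
  (i < k)%N -> (k < j)%N -> (j < n)%N -> E i k -> E k j -> E i j ->
  triangle_sum E W i j = triangle_sum E W i k + triangle_sum E W k j + W i k j.
Proof.
move=> nc ik kj jn Eik Ekj Eij.
rewrite -(@sum_triple_eq W i k j) //; [|lia|lia].
rewrite /triangle_sum -!big_split; apply: eq_bigr => x _ /=.
rewrite -!big_split; apply: eq_bigr => y _ /=.
rewrite -!big_split; apply: eq_bigr => z _ /=.
have [/and3P[Exy Eyz Exz]|nT] := boolP [&& E x y, E y z & E x z]; last first.
  rewrite !andbF.
  case: ifP => [/and3P[/eqP xi /eqP yk /eqP zj]|]; last by rewrite !addr0.
  by move: nT; rewrite xi yk zj Eik Ekj Eij.
rewrite !andbT.
have h1 : ~ (i < x < k /\ k < z)%N.
  by move=> [/andP[? ?] ?]; apply: (nc i x k z).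
have h2 : x = i :> nat -> ~ (k < z < j)%N.
  by move=> xi /andP[? ?]; apply: (nc i k z j) => //; rewrite -xi.
have h3 : x = i :> nat -> z = j :> nat -> ~ (i < y < k)%N.
  by move=> xi zj /andP[? ?]; apply: (nc i y k j) => //; rewrite -zj.
have h4 : x = i :> nat -> z = j :> nat -> ~ (k < y < j)%N.
  by move=> xi zj /andP[? ?]; apply: (nc i k y j) => //; rewrite -xi.
by case: ifP; case: ifP; case: ifP; case: ifP; lia.
Qed.

Lemma triangle_sum_side E W i : triangle_sum E W i i.+1 = 0.
Proof.
apply: big1 => x _; apply: big1 => y _; apply: big1 => z _.
by rewrite ifF //; lia.
Qed.

Definition remove_chord E (a b : nat) : rel nat :=
  fun x y => E x y && ~~ ((x == a) && (y == b)).

Section Quadrilateral.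
Variables (E : rel nat) (W : nat -> nat -> nat -> int) (a b c d : nat).
Hypotheses (ncE : chords_nc E) (ab : (a < b)%N) (bc : (b < c)%N) (cd : (c < d)%N).
Hypotheses (dn : (d < n)%N) (Eab : E a b) (Ebc : E b c) (Ecd : E c d) (Ead : E a d).

(** The only triangles using [ac] are [abc] and [acd], one on each side: [h1] to [h5] exclude every
    other third vertex by a crossing with a side of the quadrilateral. *)
Lemma triangle_sum_remove_ac : E a c ->
  triangle_sum E W 0 n.-1 =
  triangle_sum (remove_chord E a c) W 0 n.-1 + W a b c + W a c d.
Proof.
move=> Eac.
rewrite -(@sum_triple_eq W a b c) //; [|lia|lia|lia].
rewrite -(@sum_triple_eq W a c d) //; [|lia|lia].
rewrite /triangle_sum -!big_split; apply: eq_bigr => x _ /=.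
rewrite -!big_split; apply: eq_bigr => y _ /=.
rewrite -!big_split; apply: eq_bigr => z _ /=.
rewrite /remove_chord.
have [/and3P[Exy Eyz Exz]|nT] := boolP [&& E x y, E y z & E x z]; last first.
  rewrite !andbF.
  have [/and3P[/eqP e1 /eqP e2 /eqP e3]|_] :=
    boolP [&& x == a :> nat, y == b :> nat & z == c :> nat].
    by move: nT; rewrite e1 e2 e3 Eab Ebc Eac.
  have [/and3P[/eqP e1 /eqP e2 /eqP e3]|_] :=
    boolP [&& x == a :> nat, y == c :> nat & z == d :> nat].
    by move: nT; rewrite e1 e2 e3 Eac Ecd Ead.
  rewrite ifF ?addr0 //; apply: contraNF nT.
  by case/andP=> _ /and3P[/andP[-> _] /andP[-> _] /andP[-> _]].
rewrite Exy Eyz Exz /=.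
have zn := ltn_ord z.
have h1 : x = a :> nat -> z = c :> nat -> ~ (a < y < b)%N.
  move=> xa zc /andP[? ?]; apply: (@ncE a y b c) => //; first lia.
  by rewrite -zc.
have h2 : x = a :> nat -> z = c :> nat -> ~ (b < y < c)%N.
  move=> xa zc /andP[? ?]; apply: (@ncE a b y c) => //; first lia.
  by rewrite -xa.
have h3 : x = a :> nat -> y = c :> nat -> ~ (c < z < d)%N.
  move=> xa yc /andP[? ?]; apply: (@ncE a c z d) => //; first lia.
  by rewrite -xa.
have h4 : x = a :> nat -> y = c :> nat -> ~ (d < z)%N.
  move=> xa yc ?; apply: (@ncE a c d z) => //; first lia.
  by rewrite -yc.
have h5 : y = a :> nat -> z = c :> nat -> ~ (x < a)%N.
  move=> ya zc ?; apply: (@ncE x a c d) => //; first lia.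
  by rewrite -zc.
set B1 := [&& x == a :> nat, y == b :> nat & z == c :> nat].
set B2 := [&& x == a :> nat, y == c :> nat & z == d :> nat].
have -> : (z <= n.-1)%N by clear -zn; lia.
have [xyz|xyz] := boolP ((x < y) && (y < z))%N; last first.
  by rewrite !ifF ?addr0 // ?/B1 ?/B2; clear -xyz ab bc cd; lia.
case/andP: xyz => xy yz; rewrite xy yz /=.
have -> : ~~ ((x == a :> nat) && (y == c :> nat)) = ~~ B2.
  by rewrite /B1 /B2; clear -h1 h2 h3 h4 h5 xy yz ab bc cd; lia.
have -> : ~~ ((y == a :> nat) && (z == c :> nat)) = ~~ false.
  by rewrite /B1 /B2; clear -h1 h2 h3 h4 h5 xy yz ab bc cd; lia.
have -> : ~~ ((x == a :> nat) && (z == c :> nat)) = ~~ B1.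
  by rewrite /B1 /B2; clear -h1 h2 h3 h4 h5 xy yz ab bc cd; lia.
have : ~~ (B1 && B2).
  by rewrite /B1 /B2; clear -ab bc cd; lia.
by case: B1; case: B2; rewrite //= ?addr0 ?add0r.
Qed.

Lemma triangle_sum_remove_bd : E b d ->
  triangle_sum E W 0 n.-1 =
  triangle_sum (remove_chord E b d) W 0 n.-1 + W a b d + W b c d.
Proof.
move=> Ebd.
rewrite -(@sum_triple_eq W a b d) //; [|lia|lia].
rewrite -(@sum_triple_eq W b c d) //; [|lia|lia].
rewrite /triangle_sum -!big_split; apply: eq_bigr => x _ /=.
rewrite -!big_split; apply: eq_bigr => y _ /=.
rewrite -!big_split; apply: eq_bigr => z _ /=.
rewrite /remove_chord.
have [/and3P[Exy Eyz Exz]|nT] := boolP [&& E x y, E y z & E x z]; last first.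
  rewrite !andbF.
  have [/and3P[/eqP e1 /eqP e2 /eqP e3]|_] :=
    boolP [&& x == a :> nat, y == b :> nat & z == d :> nat].
    by move: nT; rewrite e1 e2 e3 Eab Ebd Ead.
  have [/and3P[/eqP e1 /eqP e2 /eqP e3]|_] :=
    boolP [&& x == b :> nat, y == c :> nat & z == d :> nat].
    by move: nT; rewrite e1 e2 e3 Ebc Ecd Ebd.
  rewrite ifF ?addr0 //; apply: contraNF nT.
  by case/andP=> _ /and3P[/andP[-> _] /andP[-> _] /andP[-> _]].
rewrite Exy Eyz Exz /=.
have zn := ltn_ord z.
have h1 : x = b :> nat -> z = d :> nat -> ~ (b < y < c)%N.
  move=> xb zd /andP[? ?]; apply: (@ncE b y c d) => //.
  by rewrite -zd.
have h2 : x = b :> nat -> z = d :> nat -> ~ (c < y < d)%N.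
  move=> xb zd /andP[? ?]; apply: (@ncE b c y d) => //.
  by rewrite -xb.
have h3 : x = b :> nat -> y = d :> nat -> ~ (d < z)%N.
  move=> xb yd ?; apply: (@ncE a b d z) => //; first lia.
  by rewrite -xb.
have h4 : y = b :> nat -> z = d :> nat -> ~ (x < a)%N.
  move=> yb zd ?; apply: (@ncE x a b d) => //; first lia.
  by rewrite -yb.
have h5 : y = b :> nat -> z = d :> nat -> ~ (a < x < b)%N.
  move=> yb zd /andP[? ?]; apply: (@ncE a x b d) => //; first lia.
  by rewrite -zd.
set B1 := [&& x == a :> nat, y == b :> nat & z == d :> nat].
set B2 := [&& x == b :> nat, y == c :> nat & z == d :> nat].
have -> : (z <= n.-1)%N by clear -zn; lia.
have [xyz|xyz] := boolP ((x < y) && (y < z))%N; last first.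
  by rewrite !ifF ?addr0 // ?/B1 ?/B2; clear -xyz ab bc cd; lia.
case/andP: xyz => xy yz; rewrite xy yz /=.
have -> : ~~ ((x == b :> nat) && (y == d :> nat)) = ~~ false.
  by rewrite /B1 /B2; clear -h1 h2 h3 h4 h5 xy yz ab bc cd; lia.
have -> : ~~ ((y == b :> nat) && (z == d :> nat)) = ~~ B1.
  by rewrite /B1 /B2; clear -h1 h2 h3 h4 h5 xy yz ab bc cd; lia.
have -> : ~~ ((x == b :> nat) && (z == d :> nat)) = ~~ B2.
  by rewrite /B1 /B2; clear -h1 h2 h3 h4 h5 xy yz ab bc cd; lia.
have : ~~ (B1 && B2).
  by rewrite /B1 /B2; clear -ab bc cd; lia.
by case: B1; case: B2; rewrite //= ?addr0 ?add0r.
Qed.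

End Quadrilateral.
End ChordRelations.

(** * A far apart pair of zigzag triangulations *)

Section ZigzagTriangulations.
Local Open Scope nat_scope.
Variable n : nat.
Hypothesis n_gt12 : 12 < n.

(* Even tube positions run up one side of the polygon, odd ones down the other. *)
Definition tube_pos (i : nat) : nat :=
  if 2 * i < n then 2 * i else 2 * (n.-1 - i) + 1.

Definition side_chord (i j : nat) : bool :=
  (j == i.+1) || (i == 0) && (j == n.-1).

(* The tube positions of [i] and [j] are [2 * i] and [2 * m + 1] when [i < j] are
   not consecutive. [zigzagU] consists of the edges of the tube whose lower end is
   even, [zigzagV] of those whose lower end is odd; apart from the sides, the
   position pairs are [(k, k + 5)], [(k, k + 7)], and at the ends [(0, 3)],
   [(1, 2)], [(1, 4)], [(n - 4, n - 1)], [(n - 5, n - 2)] and [(n - 3, n - 2)]. *)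
Definition zigzagU : rel nat := fun i j =>
  let m := n.-1 - j in
  side_chord i j ||
  [&& 2 * i < n, 2 * m + 1 < n &
    [|| m == i + 2, m == i + 3, (i == 0) && (m == 1),
        (m == i + 1) && (2 * m + 2 == n), (m == i + 1) && (2 * m + 3 == n)
      | (m == i) && (2 * m + 3 == n)]].

Definition zigzagV : rel nat := fun i j =>
  let m := n.-1 - j in
  side_chord i j ||
  [&& 2 * i < n, 2 * m + 1 < n &
    [|| i == m + 3, i == m + 4, (m == 0) && (i == 1), (m == 0) && (i == 2),
        (i == m + 2) && (2 * i + 1 == n), (i == m + 2) && (2 * i + 2 == n)
      | (i == m + 1) && (2 * i + 2 == n)]].

(** These bounds forbid crossings. With [m(x) = n - 1 - x], chords [ik] and [jl] with
    [i < j < k < l] would give [m(l) + 1 <= m(k) <= i + 3 <= j + 2], against [j + 2 <= m(l)]; the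
    alternatives for chords near the ends contradict [0 < j] or [2 m(k) + 1 < n]. *)
Lemma zigzagU_bounds i j : i.+1 < j -> j < n -> 0 < i \/ j < n.-1 ->
  zigzagU i j -> [/\ n.-1 - j <= i + 3, 2 * (n.-1 - j) + 1 < n &
    [|| i + 2 <= n.-1 - j, i == 0 | n <= 2 * (n.-1 - j) + 3]].
Proof.
rewrite /zigzagU /side_chord => ij jn nt /orP[|/and3P[_ mn H]]; first lia.
by split=> //; repeat (case/orP: H => H); clear - H mn nt jn; lia.
Qed.

(** Away from the ends, a crossing would give [j <= m(l) + 4 <= m(k) + 3 <= i], against [i < j]. *)
Lemma zigzagV_bounds i j : i.+1 < j -> j < n -> 0 < i \/ j < n.-1 ->
  zigzagV i j -> [/\ i <= n.-1 - j + 4, 2 * i < n &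
    [|| n.-1 - j + 3 <= i, j == n.-1 | n <= 2 * i + 2]].
Proof.
rewrite /zigzagV /side_chord => ij jn nt /orP[|/and3P[mn _ H]]; first lia.
by split=> //; repeat (case/orP: H => H); clear - H mn nt jn; lia.
Qed.

Lemma zigzagU_nc : chords_nc n zigzagU.
Proof.
move=> i j k l ij jk kl ln Eik Ejl.
have [] := zigzagU_bounds _ _ _ Eik; [lia|lia|lia|].
have [] := zigzagU_bounds _ _ _ Ejl; [lia|lia|lia|].
by clear Eik Ejl; lia.
Qed.

Lemma zigzagV_nc : chords_nc n zigzagV.
Proof.
move=> i j k l ij jk kl ln Eik Ejl.
have [] := zigzagV_bounds _ _ _ Eik; [lia|lia|lia|].
have [] := zigzagV_bounds _ _ _ Ejl; [lia|lia|lia|].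
by clear Eik Ejl; lia.
Qed.

(** The zigzag alternates: a chord between positions [5] apart has apex [j - 1], one between
    positions [7] apart has apex [i + 1]. The other conditions treat the two ends. *)
Lemma zigzagU_split : chords_split n zigzagU.
Proof.
move=> i j ij jn Eij.
have [up|dn] := boolP [|| (i == 0) && (j == n.-1), (i == 0) && (j == n.-2) |
    (n.-1 - j == i + 2) && (2 * (n.-1 - j) + 3 < n)].
- exists j.-1; split; [lia|lia| |rewrite /zigzagU /side_chord; clear - ij jn; lia].
  by clear Eij; repeat (case/orP: up => up); rewrite /zigzagU /side_chord; lia.
- exists i.+1; split; [lia|lia|rewrite /zigzagU /side_chord eqxx //|].
  have [ad|nad] := boolP (j == i.+2); first by rewrite /zigzagU /side_chord ad.
  move: Eij dn; rewrite {1}/zigzagU /side_chord => /orP[|/and3P[mi mn H]]; first lia.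
  have jm : (j == n.-1) = (n.-1 - j == 0) by lia.
  have jm1 : (j == n.-2) = (n.-1 - j == 1) by lia.
  have im : (j == i.+2) = (i + (n.-1 - j) + 3 == n) by lia.
  rewrite jm jm1; move: nad; rewrite im => nad dn.
  rewrite /zigzagU; apply/orP; right.
  move: (n.-1 - j) mn H dn nad => m mn H dn nad.
  clear - n_gt12 mi mn H dn nad.
  by repeat (case/orP: H => H); apply/and3P; split; lia.
Qed.

(** Here the apexes are exchanged: [i + 1] for positions [5] apart and [j - 1] for positions [7]
    apart. *)
Lemma zigzagV_split : chords_split n zigzagV.
Proof.
move=> i j ij jn Eij.
have [up|dn] := boolP ((i <= 2) && (j == n.-1) ||
    (i == n.-1 - j + 3) && (2 * i + 2 < n)).
- exists i.+1; split; [lia|lia|rewrite /zigzagV /side_chord eqxx //|].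
  by clear Eij; case/orP: up => up; rewrite /zigzagV /side_chord; lia.
- exists j.-1; split; [lia|lia| |rewrite /zigzagV /side_chord; clear - ij jn; lia].
  have [ad|nad] := boolP (j.-1 == i.+1); first by rewrite /zigzagV /side_chord ad.
  move: Eij dn; rewrite {1}/zigzagV /side_chord => /orP[|/and3P[mi mn H]]; first lia.
  have em : n.-1 - j.-1 = (n.-1 - j).+1 by lia.
  have jm : (j == n.-1) = (n.-1 - j == 0) by lia.
  have im : (j.-1 == i.+1) = (i + (n.-1 - j) + 3 == n) by lia.
  rewrite jm; move: nad; rewrite im => nad dn.
  rewrite /zigzagV em; apply/orP; right.
  move: (n.-1 - j) mn H dn nad => m mn H dn nad.
  clear - n_gt12 mi mn H dn nad.
  by repeat (case/orP: H => H); apply/and3P; split; lia.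
Qed.

Lemma zigzagU_side i j : side_chord i j -> zigzagU i j.
Proof. by rewrite /zigzagU => ->. Qed.

Lemma zigzagV_side i j : side_chord i j -> zigzagV i j.
Proof. by rewrite /zigzagV => ->. Qed.

(** This lemma and the following ones isolate the disjuncts of the two zigzags, so that memberships
    reduce to linear arithmetic; [len5] and [len7] refer to differences of tube positions. *)
Lemma zigzagU_len5 i j : j < n -> 2 * i + 5 < n -> i + j + 3 = n -> zigzagU i j.
Proof.
move=> *; apply/orP; right; apply/and3P; split; [lia|lia|].
by  apply/orP; left; lia.
Qed.

Lemma zigzagU_len7 i j : j < n -> 2 * i + 7 < n -> i + j + 4 = n -> zigzagU i j.
Proof.
move=> *; apply/orP; right; apply/and3P; split; [lia|lia|].
by apply/orP; right; apply/orP; left; lia.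
Qed.

Lemma zigzagU_low i j : j < n -> i = 0 -> j = n.-2 -> zigzagU i j.
Proof.
move=> *; apply/orP; right; apply/and3P; split; [lia|lia|].
by do 2![apply/orP; right]; apply/orP; left; lia.
Qed.

Lemma zigzagU_top1 i j : j < n -> i + j + 2 = n -> 2 * j = n -> zigzagU i j.
Proof.
move=> *; apply/orP; right; apply/and3P; split; [lia|lia|].
by do 3![apply/orP; right]; apply/orP; left; lia.
Qed.

Lemma zigzagU_top2 i j : j < n -> i + j + 2 = n -> 2 * j = n.+1 -> zigzagU i j.
Proof.
move=> *; apply/orP; right; apply/and3P; split; [lia|lia|].
by do 4![apply/orP; right]; apply/orP; left; lia.
Qed.

Lemma zigzagU_top3 i j : j < n -> i + j + 1 = n -> 2 * j = n.+1 -> zigzagU i j.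
Proof.
move=> *; apply/orP; right; apply/and3P; split; [lia|lia|].
by do 5![apply/orP; right]; lia.
Qed.

Lemma zigzagV_len5 i j : j < n -> 2 * i < n -> i + j = n + 2 -> zigzagV i j.
Proof.
move=> *; apply/orP; right; apply/and3P; split; [lia|lia|].
by  apply/orP; left; lia.
Qed.

Lemma zigzagV_len7 i j : j < n -> 2 * i < n -> i + j = n + 3 -> zigzagV i j.
Proof.
move=> *; apply/orP; right; apply/and3P; split; [lia|lia|].
by apply/orP; right; apply/orP; left; lia.
Qed.

Lemma zigzagV_low1 i j : j < n -> i = 1 -> j = n.-1 -> zigzagV i j.
Proof.
move=> *; apply/orP; right; apply/and3P; split; [lia|lia|].
by do 2![apply/orP; right]; apply/orP; left; lia.
Qed.

Lemma zigzagV_low2 i j : j < n -> i = 2 -> j = n.-1 -> zigzagV i j.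
Proof.
move=> *; apply/orP; right; apply/and3P; split; [lia|lia|].
by do 3![apply/orP; right]; apply/orP; left; lia.
Qed.

Lemma zigzagV_top1 i j : j < n -> 2 * i + 1 = n -> i + j = n + 1 -> zigzagV i j.
Proof.
move=> *; apply/orP; right; apply/and3P; split; [lia|lia|].
by do 4![apply/orP; right]; apply/orP; left; lia.
Qed.

Lemma zigzagV_top2 i j : j < n -> 2 * i + 2 = n -> i + j = n + 1 -> zigzagV i j.
Proof.
move=> *; apply/orP; right; apply/and3P; split; [lia|lia|].
by do 5![apply/orP; right]; apply/orP; left; lia.
Qed.

Lemma zigzagV_top3 i j : j < n -> 2 * i + 2 = n -> i + j = n -> zigzagV i j.
Proof.
move=> *; apply/orP; right; apply/and3P; split; [lia|lia|].
by do 6![apply/orP; right]; lia.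
Qed.

Local Open Scope ring_scope.

(** * Weights of the two zigzags *)

Definition tube_weight (x y z : nat) : int :=
  alt_weight (tube_pos x) (tube_pos y) (tube_pos z).

Lemma alt_weightD a p q r :
  alt_weight (a + p) (a + q) (a + r) = alt_weight p q r.
Proof. by rewrite /alt_weight !ltn_add2l !subnDl. Qed.

(** Translation invariance removes the common offset [a], so that a weight at variable ranks becomes
    a closed term. *)
Lemma tube_weightE a p q r x y z :
  tube_pos x = (a + p)%N -> tube_pos y = (a + q)%N -> tube_pos z = (a + r)%N ->
  tube_weight x y z = alt_weight p q r.
Proof. by rewrite /tube_weight => -> -> ->; rewrite alt_weightD. Qed.

Local Notation FU := (triangle_sum n zigzagU tube_weight).
Local Notation FV := (triangle_sum n zigzagV tube_weight).

Lemma zigzagU_step i k j : (i < k)%N -> (k < j)%N -> (j < n)%N ->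
  zigzagU i k -> zigzagU k j -> zigzagU i j ->
  FU i j = FU i k + FU k j + tube_weight i k j.
Proof. exact: triangle_sum_split zigzagU_nc. Qed.

Lemma zigzagV_step i k j : (i < k)%N -> (k < j)%N -> (j < n)%N ->
  zigzagV i k -> zigzagV k j -> zigzagV i j ->
  FV i j = FV i k + FV k j + tube_weight i k j.
Proof. exact: triangle_sum_split zigzagV_nc. Qed.

Ltac zz :=
  match goal with
  | |- is_true (zigzagU _ _) => solve
    [ apply: zigzagU_side; rewrite /side_chord; lia | apply: zigzagU_len5; lia
    | apply: zigzagU_len7; lia | apply: zigzagU_low; lia
    | apply: zigzagU_top1; lia | apply: zigzagU_top2; lia | apply: zigzagU_top3; lia ]
  | |- is_true (zigzagV _ _) => solve
    [ apply: zigzagV_side; rewrite /side_chord; lia | apply: zigzagV_len5; lia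
    | apply: zigzagV_len7; lia | apply: zigzagV_low1; lia | apply: zigzagV_low2; lia
    | apply: zigzagV_top1; lia | apply: zigzagV_top2; lia | apply: zigzagV_top3; lia ]
  | _ => lia
  end.
Ltac tw x y z a p q r v :=
  have -> : tube_weight x y z = v
    by rewrite (@tube_weightE a p q r x y z); [by vm_compute|rewrite /tube_pos; case: ifP; lia..].

(** Two triangles of scaled weight [4] are peeled off each time [i] grows by one; the last two or
    three triangles contribute [4] in total. *)
Lemma zigzagU_sum i : (2 * i + 5 < n)%N ->
  FU i (n.-1 - (i + 2))%N = (4 + 8 * ((n - 6 - 2 * i)./2))%N.
Proof.
have [d] := ubnP (n - i); elim: d i => // d IHd i di ni.
set j := (n.-1 - (i + 2))%N.
have side k : FU k k.+1 = 0 by apply: triangle_sum_side.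
have [top|ntop] := leqP n (2 * i + 7).
  have e : n = (2 * i + 6)%N \/ n = (2 * i + 7)%N by lia.
  rewrite (@zigzagU_step i i.+1 j) ?side; [|rewrite /j; case: e => e; zz..].
  rewrite (@zigzagU_step i.+1 i.+2 j) ?side; [|rewrite /j; case: e => e; zz..].
  have -> : ((n - 6 - 2 * i)./2 = 0)%N by lia.
  case: e => e.
    have -> : j = i.+3 by rewrite /j; lia.
    tw i i.+1 i.+3 (2 * i)%N 0%N 2%N 5%N (2 : int).
    by tw i.+1 i.+2 i.+3 (2 * i)%N 2%N 4%N 5%N (2 : int); rewrite side.
  rewrite (@zigzagU_step i.+2 i.+3 j) ?side; [|rewrite /j; zz..].
  have -> : j = i.+4 by rewrite /j; lia.
  tw i i.+1 i.+4 (2 * i)%N 0%N 2%N 5%N (2 : int).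
  tw i.+1 i.+2 i.+4 (2 * i)%N 2%N 4%N 5%N (2 : int).
  by tw i.+2 i.+3 i.+4 (2 * i)%N 4%N 6%N 5%N (0 : int); rewrite side.
have ej : j = j.-1.+1 by rewrite /j; lia.
rewrite (@zigzagU_step i j.-1 j); [|rewrite /j; zz..].
rewrite (@zigzagU_step i i.+1 j.-1) ?side; [|rewrite /j; zz..].
have -> : FU j.-1 j = 0 by rewrite [X in FU _ X]ej side.
have [jn nj] : (j = n - i - 3 /\ 2 * i + 8 <= n)%N by rewrite /j; lia.
tw i i.+1 j.-1 (2 * i)%N 0%N 2%N 7%N (4 : int).
tw i j.-1 j (2 * i)%N 0%N 7%N 5%N (4 : int).
have -> : j.-1 = (n.-1 - (i.+1 + 2))%N by rewrite /j; lia.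
by rewrite IHd; lia.
Qed.

(** The same peeling, with triangles of scaled weight [-4] and a total of [-4] at the far end. *)
Lemma zigzagV_sum m : (2 * m + 6 < n)%N ->
  FV (m + 3) (n.-1 - m)%N = - (4 + 8 * ((n - 7 - 2 * m)./2))%N%:Z.
Proof.
have [d] := ubnP (n - m); elim: d m => // d IHd m dm nm.
set j := (n.-1 - m)%N; set i := (m + 3)%N.
have side k : FV k k.+1 = 0 by apply: triangle_sum_side.
have ej : j = j.-1.+1 by rewrite /j; lia.
have ej2 : j.-1 = j.-2.+1 by rewrite /j; lia.
have sidej : FV j.-1 j = 0 by rewrite [X in FV _ X]ej side.
have sidej2 : FV j.-2 j.-1 = 0 by rewrite [X in FV _ X]ej2 side.
have jn : (j = n - m - 1)%N by rewrite /j; lia.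
have [top|ntop] := leqP n (2 * m + 8).
  have e : n = (2 * m + 7)%N \/ n = (2 * m + 8)%N by lia.
  rewrite (@zigzagV_step i j.-1 j) ?sidej; [|rewrite /j /i; case: e => e; zz..].
  rewrite (@zigzagV_step i j.-2 j.-1) ?sidej2; [|rewrite /j /i; case: e => e; zz..].
  have -> : ((n - 7 - 2 * m)./2 = 0)%N by lia.
  tw i j.-1 j (2 * m)%N 6%N 3%N 1%N (-2 : int).
  tw i j.-2 j.-1 (2 * m)%N 6%N 5%N 3%N (-2 : int).
  case: e => e.
    by have -> : j.-2 = i.+1 by [rewrite /j /i; lia]; rewrite side.
  rewrite (@zigzagV_step i i.+1 j.-2) ?side; [|rewrite /j /i; zz..].
  have -> : j.-2 = i.+2 by rewrite /j /i; lia.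
  by tw i i.+1 i.+2 (2 * m)%N 6%N 7%N 5%N (0 : int); rewrite side.
rewrite (@zigzagV_step i i.+1 j) ?side; [|rewrite /j /i; zz..].
rewrite (@zigzagV_step i.+1 j.-1 j); [|rewrite /j /i; zz..].
rewrite sidej.
tw i i.+1 j (2 * m)%N 6%N 8%N 1%N (-4 : int).
tw i.+1 j.-1 j (2 * m)%N 8%N 3%N 1%N (-4 : int).
have -> : j.-1 = (n.-1 - m.+1)%N by rewrite /j; lia.
have -> : i.+1 = (m.+1 + 3)%N by rewrite /i; lia.
by rewrite IHd; lia.
Qed.

(** The triangles at the low end add [4] to one sum and [-4] to the other. As
    [(n - 6)./2 + (n - 7)./2 = n - 7], the difference is [16 + 8 (n - 7)]. *)
Lemma zigzag_sum_diff : FU 0 n.-1 - FV 0 n.-1 = (4 * (2 * n - 10))%N.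
Proof.
have side k : FU k k.+1 = 0 by apply: triangle_sum_side.
have sideV k : FV k k.+1 = 0 by apply: triangle_sum_side.
have e1 : n.-1 = n.-2.+1 by lia.
have e2 : n.-2 = n.-2.-1.+1 by lia.
have s1 : FU n.-2 n.-1 = 0 by rewrite [X in FU _ X]e1 side.
have s2 : FU n.-2.-1 n.-2 = 0 by rewrite [X in FU _ X]e2 side.
rewrite (@zigzagU_step 0 n.-2 n.-1) ?s1; [|zz..].
rewrite (@zigzagU_step 0 n.-2.-1 n.-2) ?s2; [|zz..].
rewrite (@zigzagV_step 0 1 n.-1) ?sideV; [|zz..].
rewrite (@zigzagV_step 1 2 n.-1) ?sideV; [|zz..].
rewrite (@zigzagV_step 2 3 n.-1) ?sideV; [|zz..].
tw 0%N n.-2 n.-1 0%N 0%N 3%N 1%N (2 : int).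
tw 0%N n.-2.-1 n.-2 0%N 0%N 5%N 3%N (2 : int).
tw 0%N 1%N n.-1 0%N 0%N 2%N 1%N (0 : int).
tw 1%N 2%N n.-1 0%N 2%N 4%N 1%N (-2 : int).
tw 2%N 3%N n.-1 0%N 4%N 6%N 1%N (-2 : int).
have -> : n.-2.-1 = (n.-1 - (0 + 2))%N by lia.
rewrite zigzagU_sum; last lia.
have -> : FV 3 n.-1 = - (4 + 8 * ((n - 7 - 2 * 0)./2))%N%:Z.
  by rewrite -zigzagV_sum; [rewrite subn0|lia].
lia.
Qed.

Lemma tube_pos_inj i j : (i < n)%N -> (j < n)%N ->
  tube_pos i = tube_pos j -> i = j.
Proof. by clear n_gt12; rewrite /tube_pos; do 2!case: ifP; lia. Qed.

End ZigzagTriangulations.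

(** * Cyclic order of the vertices *)

Section CyclicOrder.
Local Open Scope nat_scope.
Variables (R : realType) (n : nat) (v : 'I_n -> 'rV[R]_2).
Implicit Types (T A : {set {set 'I_n}}) (e f : {set 'I_n}).

Definition interleaved (i j k l : nat) : bool :=
  (i < k < j) && (j < l) || (k < i < l) && (l < j).

(** This property carries the geometry into the combinatorial part. The enumeration has period [n],
    so that rotating the labelling is a shift of the argument. *)
Definition cyclic_order (s : nat -> 'I_n) : Prop :=
  [/\ 2 < n, forall i, s (i + n) = s i,
      forall i j, i < n -> j < n -> s i = s j -> i = j &
      forall i j k l, i < j -> j < n -> k < l -> l < n ->
        crossing v [set s i; s j] [set s k; s l] <-> interleaved i j k l].

Lemma crossingC e f : crossing v e f -> crossing v f e.
Proof. by case=> ee ef d [x [xe xf]]; split=> //; [rewrite finset.setIC|exists x; split]. Qed.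

Lemma crossing_irr e : ~ crossing v e e.
Proof. by case=> ee _; rewrite finset.setIid => e0; move: ee; rewrite /is_edge e0 cards0. Qed.

Lemma cyclic_orderS s : cyclic_order s -> cyclic_order (fun i => s i.+1).
Proof.
case=> n2 per inj cr; have s0 : s n = s 0 by rewrite -(per 0) add0n.
split=> //.
- by move=> i; rewrite -addSn per.
- move=> i j; have [->|ni] := eqVneq i n.-1; have [->|nj] := eqVneq j n.-1 => //.
  + rewrite prednK ?s0; last lia.
    by move=> _ jn /inj H; have := H ltac:(lia) ltac:(lia).
  + rewrite [in s n.-1.+1]prednK ?s0; last lia.
    by move=> jn _ /inj H; have := H ltac:(lia) ltac:(lia).
  + by move=> ? ? /inj H; have := H ltac:(lia) ltac:(lia); lia.
- move=> i j k l ij jn kl ln.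
  (* A chord ending at rank [n - 1] wraps around: that end becomes rank [0], and the two ends
     exchange their order. *)
  have sE x y : x < y -> y < n -> exists a b,
      [/\ [set s x.+1; s y.+1]%SET = [set s a; s b]%SET, a < b, b < n &
        (y < n.-1 /\ a = x.+1 /\ b = y.+1) \/ (y = n.-1 /\ a = 0 /\ b = x.+1)].
    move=> xy yn; have [ey|ny] := eqVneq y n.-1.
      exists 0, x.+1; split=> //; [|lia|by right].
      by rewrite ey prednK ?s0; [rewrite finset.setUC|lia].
    by exists x.+1, y.+1; split=> //; [lia|left; lia].
  have [a [b [-> ab bn hab]]] := sE i j ij jn.
  have [c [d [-> cd dn hcd]]] := sE k l kl ln.
  rewrite cr //; suff -> : interleaved a b c d = interleaved i j k l by [].
  by rewrite /interleaved; case: hab => -[? [? ?]]; case: hcd => -[? [? ?]]; lia.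
Qed.

Lemma cyclic_orderD s m : cyclic_order s -> cyclic_order (fun i => s (i + m)).
Proof.
move=> cs; elim: m => [|m IHm].
  by have -> : (fun i => s (i + 0)) = s by apply/funext => i; rewrite addn0.
have -> : (fun i => s (i + m.+1)) = (fun i => s (i.+1 + m)).
  by apply/funext => i; rewrite addSnnS.
exact: (cyclic_orderS IHm).
Qed.

Section Fixed.
Variable s : nat -> 'I_n.
Hypothesis cs : cyclic_order s.

Let n2 : 2 < n. Proof. by case: cs. Qed.
Let s_inj i j : i < n -> j < n -> s i = s j -> i = j.
Proof. by case: cs => _ _ H _; apply: H. Qed.
Let s_cross i j k l : i < j -> j < n -> k < l -> l < n ->
  crossing v [set s i; s j] [set s k; s l] <-> interleaved i j k l.
Proof. by case: cs => _ _ _; apply. Qed.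

Lemma cyclic_order_bij : bijective (fun i : 'I_n => s i).
Proof.
apply: injF_bij => i j /s_inj H; apply: val_inj; exact: H.
Qed.

Lemma cyclic_order_surj x : exists2 i, i < n & s i = x.
Proof.
have [g _ gK] := cyclic_order_bij.
by exists (g x) => //; apply: gK.
Qed.

Lemma cyclic_order_edge i j : i < j -> j < n -> is_edge [set s i; s j].
Proof.
move=> ij jn; rewrite /is_edge cards2.
by have -> : s i != s j by apply/eqP => /s_inj H; have := H ltac:(lia) ltac:(lia); lia.
Qed.

Lemma edge_ranks e : is_edge e ->
  exists i j, [/\ i < j, j < n & e = [set s i; s j]%SET].
Proof.
move=> /eqP/cards2P[x [y [xy ->]]].
have [i ni ei] := cyclic_order_surj x; have [j nj ej] := cyclic_order_surj y.
rewrite -ei -ej; have [ij|ji|ij] := ltngtP i j.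
- by exists i, j.
- by exists j, i; rewrite finset.setUC.
- by move: xy; rewrite -ej -ei ij eqxx.
Qed.

Lemma edge_ranks_eq i j k l : i < j -> j < n -> k < l -> l < n ->
  ([set s i; s j]%SET == [set s k; s l]%SET) = (i == k) && (j == l).
Proof.
move=> ij jn kl ln; apply/eqP/andP => [e|[/eqP -> /eqP ->]//].
have mem x : x < n -> s x \in [set s i; s j]%SET -> x = i \/ x = j.
  by move=> xn; rewrite !inE => /orP[/eqP/s_inj H|/eqP/s_inj H]; [left|right]; apply: H; lia.
have := mem k ltac:(lia); rewrite e !inE eqxx => /(_ isT) hk.
have := mem l ltac:(lia); rewrite e !inE eqxx orbT => /(_ isT) hl.
by clear - hk hl ij kl; lia.
Qed.

Definition chord T : rel nat := fun i j => [set s i; s j]%SET \in T.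

(** Adding such a chord keeps [T] noncrossing, so maximality already puts it in [T]. *)
Lemma triangulation_mem T i j : triangulation v T -> i < j -> j < n ->
  (forall k l, k < l -> l < n -> chord T k l -> ~~ interleaved i j k l) ->
  chord T i j.
Proof.
move=> [[eT ncT] maxT] ij jn H; set e := [set s i; s j]%SET.
have ee : is_edge e by apply: cyclic_order_edge.
have nce f : f \in T -> ~ crossing v e f.
  move=> fT; have [k [l [kl ln ef]]] := edge_ranks (eT _ fT).
  by rewrite ef => /s_cross-/(_ ij jn kl ln); apply/negP/H => //; rewrite /chord -ef.
rewrite /chord -(maxT (e |: T)%SET) ?finset.subsetUr ?finset.setU11 //; split=> [f|f g].
  by rewrite !inE => /orP[/eqP -> //|/eT].
rewrite !inE => /orP[/eqP ->|fT] /orP[/eqP ->|gT].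
- exact: crossing_irr.
- exact: nce.
- by move/crossingC; apply: nce.
- exact: ncT.
Qed.

Lemma noncrossing_chords T : noncrossing_edges v T -> chords_nc n (chord T).
Proof.
move=> [_ ncT] i j k l ij jk kl ln Eik Ejl.
apply: (ncT _ _ Eik Ejl); apply/s_cross; rewrite ?/interleaved; lia.
Qed.

Lemma triangulation_nc T : triangulation v T -> chords_nc n (chord T).
Proof. by case=> /noncrossing_chords. Qed.

Lemma triangulation_side T i : triangulation v T -> i.+1 < n -> chord T i i.+1.
Proof.
by move=> tT ni; apply: triangulation_mem => // k l kl ln _; rewrite /interleaved; lia.
Qed.

Lemma triangulation_top T : triangulation v T -> chord T 0 n.-1.
Proof.
by move=> tT; apply: triangulation_mem => //; [lia|lia|] => k l kl ln _; rewrite /interleaved; lia.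
Qed.

Lemma triangulation_split T : triangulation v T -> chords_split n (chord T).
Proof.
move=> tT i j ij jn Eij; have nc := triangulation_nc tT.
(* The apex is the largest [c < j] joined to [i]: a chord crossing [cj] would cross [ij] or [ic], or
   contradict this choice. *)
pose P c := [&& i < c, c < j & chord T i c].
have exP : exists c, P c.
  by exists i.+1; rewrite /P ltnSn ij triangulation_side //; lia.
have ubP c : P c -> c <= j by case/and3P=> _ /ltnW.
case: (ex_maxnP exP ubP) => c /and3P[ic cj Eic] maxc.
exists c; split=> //; apply: triangulation_mem => // k l kl ln Ekl.
apply/negP; rewrite /interleaved => H.
have [/andP[/andP[ck kj] jl]|/andP[/andP[kc cl] lj]] := orP H.
  by apply: (nc i k j l) => //; lia.
have [ki|ik|ki] := ltngtP k i.
- by apply: (nc k i l j) => //; lia.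
- by apply: (nc i k c l) => //; lia.
- have := maxc l; rewrite /P -ki Ekl; lia.
Qed.

Lemma triangulation_of_split T : noncrossing_edges v T ->
  chords_split n (chord T) -> chord T 0 n.-1 -> triangulation v T.
Proof.
move=> ncT sp top; split=> // A [eA ncA] TA; apply/eqP; rewrite finset.eqEsubset TA andbT.
apply/fintype.subsetP => e eA'; have [i [j [ij jn ee]]] := edge_ranks (eA _ eA').
have [//|nT] := boolP (e \in T); exfalso.
have [|a [b [ab bn Eab H]]] := chords_split_maximal sp top ij jn.
  by rewrite /chord -ee.
apply: (ncA _ _ eA' (fintype.subsetP TA _ Eab)).
by rewrite ee; apply/s_cross => //; rewrite /interleaved; lia.
Qed.

(** A chord that enters a quadrilateral through none of its sides runs from corner to corner. Hence
    a noncrossing set containing the four sides has little freedom inside. *)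
Lemma quad_diag_cross i j k l x y : i < j -> j < k -> k < l -> x < y ->
  interleaved j l x y -> ~~ interleaved i j x y -> ~~ interleaved j k x y ->
  ~~ interleaved k l x y -> ~~ interleaved i l x y -> x = i /\ y = k.
Proof. by rewrite /interleaved; lia. Qed.

Lemma quad_diag_cross' i j k l x y : i < j -> j < k -> k < l -> x < y ->
  interleaved i k x y -> ~~ interleaved i j x y -> ~~ interleaved j k x y ->
  ~~ interleaved k l x y -> ~~ interleaved i l x y -> x = j /\ y = l.
Proof. by rewrite /interleaved; lia. Qed.

Lemma noncrossing_chord_interleaved T i j k l : noncrossing_edges v T ->
  i < j -> j < n -> k < l -> l < n -> chord T i j -> chord T k l ->
  ~~ interleaved i j k l.
Proof.
move=> [_ ncT] ij jn kl ln Eij Ekl; apply/negP => H.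
by apply: (ncT _ _ Eij Ekl); apply/s_cross.
Qed.

(** * Flips inside a quadrilateral *)

Section Quad.
Variables (T : {set {set 'I_n}}) (i j k l : nat).
Hypotheses (tT : triangulation v T) (ij : i < j) (jk : j < k) (kl : k < l) (ln : l < n).
Hypotheses (Eij : chord T i j) (Ejk : chord T j k) (Ekl : chord T k l) (Eil : chord T i l).
Hypothesis Eik : chord T i k.

Let ik := [set s i; s k]%SET.
Let jl := [set s j; s l]%SET.
Let T' := (jl |: (T :\ ik))%SET.

Let jn : j < n. Proof. by rewrite (ltn_trans jk) // (ltn_trans kl). Qed.
Let kn : k < n. Proof. by rewrite (ltn_trans kl). Qed.
Let lt_ik : i < k. Proof. by rewrite (ltn_trans ij). Qed.
Let lt_jl : j < l. Proof. by rewrite (ltn_trans jk). Qed.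
Let lt_il : i < l. Proof. by rewrite (ltn_trans ij). Qed.

Let cross_ik_jl : crossing v ik jl.
Proof. by apply/s_cross => //; rewrite /interleaved ij jk kl. Qed.

Lemma quad_sides_kept A : (T :\ ik \subset A)%SET ->
  [/\ chord A i j, chord A j k, chord A k l & chord A i l].
Proof.
move=> /fintype.subsetP sA.
by split; apply: sA; rewrite in_setD1; apply/andP; split=> //;
  rewrite /ik edge_ranks_eq //; clear - ij jk kl; lia.
Qed.

Lemma quad_only_ik A x y : noncrossing_edges v A -> (T :\ ik \subset A)%SET ->
  x < y -> y < n -> chord A x y -> interleaved j l x y -> x = i /\ y = k.
Proof.
move=> ncA /quad_sides_kept[Aij Ajk Akl Ail] xy yn Axy H.
by apply: (quad_diag_cross ij jk kl xy H);
  apply: (noncrossing_chord_interleaved ncA).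
Qed.

Lemma quad_only_jl A x y : noncrossing_edges v A -> (T :\ ik \subset A)%SET ->
  x < y -> y < n -> chord A x y -> interleaved i k x y -> x = j /\ y = l.
Proof.
move=> ncA /quad_sides_kept[Aij Ajk Akl Ail] xy yn Axy H.
by apply: (quad_diag_cross' ij jk kl xy H);
  apply: (noncrossing_chord_interleaved ncA).
Qed.

Lemma quad_flip_noncrossing : noncrossing_edges v T'.
Proof.
have [[eT ncT] _] := tT.
have nce f : f \in (T :\ ik)%SET -> ~ crossing v jl f.
  rewrite in_setD1 => /andP[fik fT].
  have [x [y [xy yn ef]]] := edge_ranks (eT _ fT).
  rewrite ef => /s_cross-/(_ lt_jl ln xy yn) H.
  have Exy : chord T x y by rewrite /chord -ef.
  have [ex ey] := quad_only_ik (proj1 tT) (subD1set _ _) xy yn Exy H.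
  by move: fik; rewrite ef ex ey eqxx.
split=> [f|f g]; rewrite !in_setU1.
  case/orP=> [/eqP ->|]; first exact: cyclic_order_edge.
  by rewrite in_setD1 => /andP[_ /eT].
move=> /orP[/eqP ->|fT] /orP[/eqP ->|gT].
- exact: crossing_irr.
- exact: nce.
- by move/crossingC; apply: nce.
- by move: fT gT; rewrite !in_setD1 => /andP[_ fT] /andP[_ gT]; apply: ncT.
Qed.

(** A chord of a larger noncrossing set that is missing from [T] either crosses [ik], and then is
    [jl], or crosses nothing in [T], which the maximality of [T] forbids. *)
Lemma quad_flip_triangulation : triangulation v T'.
Proof.
split=> [|A ncA T'A]; first exact: quad_flip_noncrossing.
have TA : (T :\ ik \subset A)%SET.
  by apply: fintype.subset_trans T'A; apply: finset.subsetUr.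
have jlA : jl \in A by apply: (fintype.subsetP T'A); rewrite finset.setU11.
apply/eqP; rewrite finset.eqEsubset T'A andbT; apply/fintype.subsetP => e eA.
have [x [y [xy yn ee]]] := edge_ranks (proj1 ncA _ eA).
have [eT|eT] := boolP (e \in T).
  rewrite !inE eT andbT; have [eik|//] := eqVneq e ik; last by rewrite orbT.
  by case: (proj2 ncA _ _ eA jlA); rewrite eik.
have [H|nH] := boolP (interleaved i k x y).
  have Axy : chord A x y by rewrite /chord -ee.
  have [ex ey] := quad_only_jl ncA TA xy yn Axy H.
  by rewrite ee ex ey finset.setU11.
case/negP: eT; rewrite ee; apply: triangulation_mem => // c d cd dn Ecd.
have [e1|ne1] := eqVneq [set s c; s d]%SET ik.
  move/eqP: e1; rewrite edge_ranks_eq //.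
  move=> /andP[/eqP -> /eqP ->]; apply: contra nH.
  by rewrite /interleaved; clear; lia.
apply: (noncrossing_chord_interleaved ncA) => //; first by rewrite /chord -ee.
by apply: (fintype.subsetP TA); rewrite in_setD1 ne1.
Qed.

Lemma quad_flip_adj : flip_adj v T T'.
Proof.
split=> //; first exact: quad_flip_triangulation.
exists (s i), (s j), (s k), (s l); split=> //.
- split; first exact: cyclic_order_edge.
  by exists jl; apply: cross_ik_jl.
- by split=> //; rewrite finset.setUC.
Qed.

(** Only [ik] could prevent [A] from containing [jl], so [A] contains one of the two diagonals. *)
Lemma quad_two_triangulations A : triangulation v A -> (T :\ ik \subset A)%SET ->
  A = T \/ A = T'.
Proof.
move=> tA TA; have [ikA|ikA] := boolP (ik \in A).
  left; case: tT => _ maxT; apply: maxT; first by case: tA.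
  apply/fintype.subsetP => e eT; have [->//|eik] := eqVneq e ik.
  by apply: (fintype.subsetP TA); rewrite in_setD1 eik.
right; apply: (proj2 quad_flip_triangulation); first by case: tA.
suff jlA : jl \in A.
  apply/fintype.subsetP => e; rewrite in_setU1 => /orP[/eqP -> //|].
  exact: (fintype.subsetP TA).
apply: triangulation_mem => // x y xy yn Axy; apply/negP => H.
have [ex ey] := quad_only_ik (proj1 tA) TA xy yn Axy H.
by move: ikA; rewrite /ik -ex -ey -/(chord A x y) Axy.
Qed.

End Quad.

End Fixed.
End CyclicOrder.

(** * The potential of a triangulation *)

Lemma triangle_sum_ext n (E E' : rel nat) W i j :
  (forall x y, (x < y)%N -> (y < n)%N -> E x y = E' x y) ->
  triangle_sum n E W i j = triangle_sum n E' W i j.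
Proof.
move=> eE; apply: eq_bigr => x _; apply: eq_bigr => y _; apply: eq_bigr => z _.
have [/and4P[ix xy yz zj]|//] := boolP [&& i <= x, x < y, y < z & z <= j]%N.
by rewrite !eE // (ltn_trans xy yz).
Qed.

Section FlipPotential.
Local Open Scope nat_scope.
Variables (R : realType) (n : nat) (v : 'I_n -> 'rV[R]_2).
Implicit Types (T A : {set {set 'I_n}}) (e f : {set 'I_n}).

Lemma flip_edges_neq a b c d : crossing v [set a; c] [set b; d] ->
  [/\ [set a; b] != [set a; c], [set b; c] != [set a; c],
      [set c; d] != [set a; c] & [set d; a] != [set a; c]]%SET.
Proof.
case=> _ _ /finset.setP dis _.
have b' : b \notin [set a; c]%SET.
  by have := dis b; rewrite !inE eqxx /= andbT => ->.
have d' : d \notin [set a; c]%SET.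
  by have := dis d; rewrite !inE eqxx orbT andbT => ->.
by split; [apply: contra b'|apply: contra b'|apply: contra d'|apply: contra d'];
  move=> /eqP <-; rewrite !inE eqxx ?orbT.
Qed.

Lemma flip_adj_sym T T' : flip_adj v T T' -> flip_adj v T' T.
Proof.
move=> [tT tT' [a [b [c [d [acT iac cr [ab bc cd da] eT']]]]]]; split=> //.
have [n1 n2 n3 n4] := flip_edges_neq cr.
have cr' : crossing v [set b; d]%SET [set c; a]%SET.
  by rewrite (finset.setUC [set c]); apply: crossingC.
have bdT : [set b; d]%SET \notin T.
  by apply/negP => bdT; case: tT => -[_ nc] _; apply: (nc _ _ acT bdT).
exists b, c, d, a; split=> //.
- by rewrite eT' finset.setU11.
- by split; [case: cr'|exists [set c; a]%SET].
- by split; rewrite eT' in_setU1 in_setD1 ?bc ?cd ?da ?ab ?n1 ?n2 ?n3 ?n4 orbT.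
- rewrite (finset.setUC [set c]) eT'; apply/finset.setP => e.
  rewrite !(in_setU1, in_setD1); have [->|eac] /= := eqVneq e [set a; c]%SET; first by [].
  have [eb|] //= := eqVneq e [set b; d]%SET.
  by rewrite eb; apply/negbTE.
Qed.

Section Fixed.
Variable s : nat -> 'I_n.
Hypothesis cs : cyclic_order v s.

(** Once the corners are sorted by rank, the removed diagonal joins either the first and third or
    the second and fourth of them, whence the two alternatives. *)
Lemma flip_ranks T T' : flip v T T' -> exists i j k l,
  [/\ i < j, j < k, k < l & l < n] /\
  [/\ chord s T i j, chord s T j k, chord s T k l & chord s T i l] /\
  (chord s T i k /\ T' = ([set s j; s l] |: (T :\ [set s i; s k]))%SET \/
   chord s T j l /\ T' = ([set s i; s k] |: (T :\ [set s j; s l]))%SET).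
Proof.
move=> [a [b [c [d [acT _ cr [ab bc cd da] eT']]]]].
have [ia na ea] := cyclic_order_surj cs a; have [ib nb eb] := cyclic_order_surj cs b.
have [ic nc ec] := cyclic_order_surj cs c; have [id nd ed] := cyclic_order_surj cs d.
have [_ _ _ crE] := cs.
move: acT cr ab bc cd da eT'; rewrite /chord; subst a b c d => acT cr ab bc cd da eT'.
have cards : is_edge [set s ia; s ic]%SET /\ is_edge [set s ib; s id]%SET by case: cr.
have nac : ia != ic.
  by apply/eqP => e; case: cards; rewrite /is_edge e finset.setUid cards1.
have nbd : ib != id.
  by apply/eqP => e; case: cards => _; rewrite /is_edge e finset.setUid cards1.
have C (x y : 'I_n) : [set x; y]%SET = [set y; x]%SET by rewrite finset.setUC.
have memC x y : [set x; y]%SET \in T -> [set y; x]%SET \in T by rewrite C.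
have interl : interleaved (minn ia ic) (maxn ia ic) (minn ib id) (maxn ib id).
  apply/crE; [lia|lia|lia|lia|].
  have mm x y : [set s (minn x y); s (maxn x y)]%SET = [set s x; s y]%SET.
    by rewrite /minn /maxn; case: ifP; rewrite // C.
  by rewrite !mm.
have key i j k l : i < j -> j < k -> k < l -> l < n ->
    [set s i; s j]%SET \in T -> [set s j; s k]%SET \in T ->
    [set s k; s l]%SET \in T -> [set s i; s l]%SET \in T ->
    ([set s i; s k] = [set s ia; s ic] /\ [set s j; s l] = [set s ib; s id] \/
     [set s i; s k] = [set s ib; s id] /\ [set s j; s l] = [set s ia; s ic])%SET ->
    exists i j k l,
      [/\ i < j, j < k, k < l & l < n] /\
      [/\ chord s T i j, chord s T j k, chord s T k l & chord s T i l] /\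
      (chord s T i k /\ T' = ([set s j; s l] |: (T :\ [set s i; s k]))%SET \/
       chord s T j l /\ T' = ([set s i; s k] |: (T :\ [set s j; s l]))%SET).
  move=> ij jk kl ln Eij Ejk Ekl Eil [[e1 e2]|[e1 e2]]; exists i, j, k, l;
    split=> //; split=> //; [left|right]; by rewrite /chord e1 e2.
move: interl; rewrite /interleaved.
case: (ltngtP ia ic) nac => // ac _; case: (ltngtP ib id) nbd => // bd _ H.
- have [/andP[/andP[? ?] ?]|/andP[/andP[? ?] ?]] := orP H.
    by apply: (key ia ib ic id) => //; try exact: memC; left.
  by apply: (key ib ia id ic) => //; try exact: memC; right.
- have [/andP[/andP[? ?] ?]|/andP[/andP[? ?] ?]] := orP H.
    by apply: (key ia id ic ib) => //; try exact: memC; left; split; rewrite // C.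
  by apply: (key id ia ib ic) => //; try exact: memC; right; split; rewrite // C.
- have [/andP[/andP[? ?] ?]|/andP[/andP[? ?] ?]] := orP H.
    by apply: (key ic ib ia id) => //; try exact: memC; left; split; rewrite // C.
  by apply: (key ib ic id ia) => //; try exact: memC; right; split; rewrite // C.
- have [/andP[/andP[? ?] ?]|/andP[/andP[? ?] ?]] := orP H.
    by apply: (key ic id ia ib) => //; try exact: memC; left; split; rewrite C.
  by apply: (key id ic ib ia) => //; try exact: memC; right; split; rewrite C.
Qed.

(** The linear functional of the duality argument, scaled by [4]; triples of increasing rank all
    have the same orientation along the polygon. *)
Definition potential T : int :=
  triangle_sum n (chord s T) (tube_weight n) 0 n.-1.

Lemma quad_flip_potential T i j k l : triangulation v T ->
  i < j -> j < k -> k < l -> l < n ->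
  chord s T i j -> chord s T j k -> chord s T k l -> chord s T i l -> chord s T i k ->
  (`|potential ([set s j; s l] |: (T :\ [set s i; s k]))%SET - potential T| <= 4)%R.
Proof.
move=> tT ij jk kl ln Eij Ejk Ekl Eil Eik.
set T' := (_ |: _)%SET.
have [i_n jn kn] : [/\ i < n, j < n & k < n] by split; clear - ij jk kl ln; lia.
have [ik jl] : i < k /\ j < l by rewrite (ltn_trans ij jk) (ltn_trans jk kl).
have tT' : triangulation v T' by apply: quad_flip_triangulation.
have [Fij Fjk Fkl Fil] :
    [/\ chord s T' i j, chord s T' j k, chord s T' k l & chord s T' i l].
  apply: (quad_sides_kept cs ij jk kl ln Eij Ejk Ekl Eil).
  exact: finset.subsetUr.
have Fjl : chord s T' j l by rewrite /chord finset.setU11.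
(* The two chord relations agree once the diagonals are removed, so only the four triangles of the
   quadrilateral contribute to the difference. *)
have rem x y : x < y -> y < n ->
    remove_chord (chord s T) i k x y = remove_chord (chord s T') j l x y.
  move=> xy yn; rewrite /remove_chord /T' /chord in_setU1 in_setD1.
  rewrite !(edge_ranks_eq cs) //.
  have [e|ne] /= := boolP ((x == j) && (y == l)); last by rewrite andbT andbC.
  have /negPf nT : ~~ chord s T j l.
    by apply/negP => /(triangulation_nc cs tT ij jk kl ln Eik).
  by case/andP: e => /eqP -> /eqP ->; rewrite -/(chord s T j l) nT.
rewrite /potential.
rewrite (triangle_sum_remove_ac _ (triangulation_nc cs tT) ij jk kl ln) //.
rewrite (triangle_sum_remove_bd _ (triangulation_nc cs tT') ij jk kl ln) //.
rewrite (triangle_sum_ext _ _ _ rem).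
set W := tube_weight n.
(* What remains is the coboundary on four tube positions, distinct because [tube_pos] is injective
   on ranks. *)
have := @alt_weight_coboundary_le4 (tube_pos n i) (tube_pos n j) (tube_pos n k) (tube_pos n l).
rewrite -!/(tube_weight n _ _ _) -/W.
have inj x y : x < n -> y < n -> x != y -> tube_pos n x != tube_pos n y.
  by move=> xn yn; apply: contra => /eqP/tube_pos_inj H; apply/eqP/H.
by rewrite /= !inE !negb_or !inj // ?andbT; clear - ij jk kl; lia.
Qed.

Lemma flip_potential T T' : flip_adj v T T' ->
  (`|potential T' - potential T| <= 4)%R.
Proof.
move=> fT; have [tT tT' /flip_ranks] := fT.
move=> [i [j [k [l [[ij jk kl ln] [[Eij Ejk Ekl Eil] [[Eik ->]|[Ejl eT']]]]]]]].
  exact: quad_flip_potential.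
have ikT : [set s i; s k]%SET \notin T.
  apply/negP => ikT; apply: (triangulation_nc cs tT ij jk kl ln ikT Ejl).
have sub x y : x < y -> y < n -> (x, y) != (j, l) -> chord s T x y -> chord s T' x y.
  move=> xy yn ne Exy; rewrite /chord eT' in_setU1 in_setD1.
  rewrite !(edge_ranks_eq cs) //; try by clear - ij jk kl ln; lia.
  by rewrite -!xpair_eqE ne [_ \in T]Exy orbT.
(* If [jl] is the removed diagonal, the reverse flip from [T'] to [T] is of the kind already
   treated. *)
have -> : T = ([set s j; s l] |: (T' :\ [set s i; s k]))%SET.
  apply/finset.setP => e; rewrite eT' !(in_setU1, in_setD1).
  have [->|ne1] /= := eqVneq e [set s j; s l]%SET; first exact: Ejl.
  by have [->|] //= := eqVneq e [set s i; s k]%SET; apply/negbTE.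
rewrite distrC; apply: quad_flip_potential => //.
- by apply: sub => //; [lia|apply/eqP => -[]; lia].
- by apply: sub => //; [lia|apply/eqP => -[]; lia].
- by apply: sub => //; apply/eqP => -[]; lia.
- by apply: sub => //; [lia|apply/eqP => -[]; lia].
- by rewrite /chord eT' finset.setU11.
Qed.

Lemma walk_potential T T' m : walk (flip_adj v) m T T' ->
  (`|potential T' - potential T| <= 4 * m%:Z)%R.
Proof.
elim: m T => [|m IHm] T /=; first by move=> ->; rewrite subrr.
by move=> [T1 /flip_potential h1 /IHm]; lia.
Qed.

(** * Lower bound from the zigzag triangulations *)

Definition chord_set (E : rel nat) : {set {set 'I_n}} :=
  [set e | [exists i : 'I_n, exists j : 'I_n,
     [&& i < j, E i j & e == [set s i; s j]%SET]]]%SET.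

Lemma chord_chord_set E i j : i < j -> j < n -> chord s (chord_set E) i j = E i j.
Proof.
move=> ij jn; have ni : i < n by apply: ltn_trans jn.
rewrite /chord inE; apply/existsP/idP => [[x /existsP[y]]|Eij].
  case/and3P=> xy Exy; rewrite (edge_ranks_eq cs) // => /andP[/eqP -> /eqP ->].
  exact: Exy.
exists (Ordinal ni); apply/existsP; exists (Ordinal jn); apply/and3P; split=> //.
Qed.

Lemma chord_set_triangulation E : chords_nc n E -> chords_split n E ->
  E 0 n.-1 -> triangulation v (chord_set E).
Proof.
move=> nc sp top; have [n2 _ _ crE] := cs.
have mem e : e \in chord_set E -> exists i j, [/\ i < j, j < n, E i j & e = [set s i; s j]%SET].
  rewrite inE => /existsP[i /existsP[j /and3P[ij Eij /eqP ->]]].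
  by exists i, j.
apply: (triangulation_of_split cs).
- split=> [e /mem[i [j [ij jn Eij ->]]]|e f /mem[i [j [ij jn Eij ->]]] /mem[k [l [kl ln Ekl ->]]]].
    exact: (cyclic_order_edge cs).
  move=> /crE-/(_ ij jn kl ln); rewrite /interleaved.
  move=> /orP[/andP[/andP[? ?] ?]|/andP[/andP[? ?] ?]].
    exact: (nc i k j l).
  exact: (nc k i l j).
- move=> i j ij jn; rewrite chord_chord_set //; last lia.
  move=> Eij; have [k [ik kj Eik Ekj]] := sp i j ij jn Eij.
  by exists k; split=> //; rewrite chord_chord_set //; lia.
- by rewrite chord_chord_set //; lia.
Qed.

Lemma zigzag_distance : 12 < n ->
  exists T T', [/\ triangulation v T, triangulation v T' &
    forall m, walk (flip_adj v) m T T' -> 2 * n - 10 <= m].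
Proof.
move=> n12; exists (chord_set (zigzagV n)), (chord_set (zigzagU n)); split.
- by apply: chord_set_triangulation;
    [exact: zigzagV_nc|exact: zigzagV_split|rewrite /zigzagV /side_chord !eqxx orbT].
- by apply: chord_set_triangulation;
    [exact: zigzagU_nc|exact: zigzagU_split|rewrite /zigzagU /side_chord !eqxx orbT].
- move=> m /walk_potential; rewrite /potential.
  rewrite (@triangle_sum_ext _ (chord s (chord_set (zigzagU n))) (zigzagU n)); last first.
    by move=> *; apply: chord_chord_set.
  rewrite (@triangle_sum_ext _ (chord s (chord_set (zigzagV n))) (zigzagV n)); last first.
    by move=> *; apply: chord_chord_set.
  by rewrite zigzag_sum_diff //; lia.
Qed.

End Fixed.
End FlipPotential.

(** * Diameter of the flip graph *)

Section Walks.
Local Open Scope nat_scope.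
Variables (S : Type) (adj : S -> S -> Prop).

Lemma walk_cat k l x y z : walk adj k x y -> walk adj l y z -> walk adj (k + l) x z.
Proof.
elim: k x => [|k IHk] x /=; first by move=> ->.
by move=> [t xt /IHk ty] yz; exists t => //; apply: ty.
Qed.

Lemma walk_sym k x y : (forall a b, adj a b -> adj b a) ->
  walk adj k x y -> walk adj k y x.
Proof.
move=> sym; elim: k x => [|k IHk] x /=; first by move=> ->.
move=> [t /sym tx /IHk ty].
suff : walk adj (k + 1) y x by rewrite addn1.
by apply: walk_cat ty _; exists x.
Qed.

Lemma graph_dist_ex k x y : walk adj k x y ->
  exists2 m, graph_dist adj x y m & m <= k.
Proof.
move=> w; have exP : exists m, `[< walk adj m x y >] by exists k; apply/asboolP.
case: (ex_minnP exP) => m /asboolP wm minm; exists m.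
  by split=> // j wj; apply/minm/asboolP.
by apply/minm/asboolP.
Qed.

End Walks.

(** * Upper bound through fans *)

Section UpperBound.
Local Open Scope nat_scope.
Variables (R : realType) (n : nat) (v : 'I_n -> 'rV[R]_2).
Implicit Types (T A : {set {set 'I_n}}) (e f : {set 'I_n}) (p q : 'I_n).
Variable s0 : nat -> 'I_n.
Hypothesis cs0 : cyclic_order v s0.

(** Polygon sides are counted too: in a triangulation this is the interior degree plus [2], and it
    is [n - 1] for the apex of a fan. *)
Definition degree T p : nat := \sum_(q < n) (q != p) && ([set p; q]%SET \in T).

Lemma cyclic_order_at p : exists2 s, cyclic_order v s & s 0 = p.
Proof.
have [m _ sm] := cyclic_order_surj cs0 p.
by exists (fun i => s0 (i + m)); [apply: cyclic_orderD|].
Qed.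

Lemma degree_chord s T : cyclic_order v s ->
  degree T (s 0) = \sum_(i < n) (i != 0 :> nat) && chord s T 0 i.
Proof.
move=> cs; have [n2 _ inj _] := cs.
rewrite /degree (reindex (fun i : 'I_n => s i)) /=; last first.
  exact: onW_bij (cyclic_order_bij cs).
apply: eq_bigr => i _; congr (nat_of_bool (_ && _)).
apply/idP/idP; apply: contra => /eqP; first by move=> ->.
by move=> /inj H; apply/eqP; apply: H => //; lia.
Qed.

(** Each of the [2n - 3] edges is counted from both ends; exchanging the summation indices matches
    the second count with the first. *)
Lemma degree_sum T : triangulation v T -> \sum_p degree T p = 4 * n - 6.
Proof.
move=> tT; have [n2 _ inj _] := cs0.
have bij := onW_bij xpredT (cyclic_order_bij cs0).
have <- : 2 * edge_count n (chord s0 T) 0 n.-1 = 4 * n - 6.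
  rewrite (edge_count_chord (triangulation_nc cs0 tT) (triangulation_split cs0 tT)) //; try lia.
  - exact: (triangulation_top cs0 tT).
  - by move=> k kn; apply: (triangulation_side cs0 tT).
rewrite (reindex (fun i : 'I_n => s0 i)) //=.
under eq_bigr do rewrite /degree (reindex (fun i : 'I_n => s0 i)) //=.
have e2 : edge_count n (chord s0 T) 0 n.-1 = \sum_(i < n) \sum_(j < n)
    [&& 0 <= j, j < i, i <= n.-1 & chord s0 T j i] by exact: exchange_big.
rewrite mul2n -addnn {2}e2 -big_split; apply: eq_bigr => i _ /=.
rewrite -big_split; apply: eq_bigr => j _ /=.
have -> : (s0 j != s0 i) = (j != i :> nat).
  congr (~~ _); apply/eqP/eqP => [/inj H|->//]; exact: H.
have [ni nj] := (ltn_ord i, ltn_ord j).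
rewrite /chord (finset.setUC [set s0 j]%SET).
case: (_ \in T); rewrite ?andbF ?andbT //; lia.
Qed.

Lemma degree_le T p : degree T p <= n.-1.
Proof.
rewrite /degree (bigD1 p) //= eqxx add0n.
apply: (@leq_trans (\sum_(q < n | q != p) 1)).
  by apply: leq_sum => q _; case: (_ && _).
by rewrite sum1_card cardC1 card_ord.
Qed.

Lemma degree_lt_missing s T : cyclic_order v s -> degree T (s 0) < n.-1 ->
  exists m, [/\ 0 < m, m < n & ~~ chord s T 0 m].
Proof.
move=> cs; have [n2 _ _ _] := cs; rewrite (degree_chord _ cs) => dlt.
have [/forallP all1|] := boolP [forall i : 'I_n, (i != 0 :> nat) ==> chord s T 0 i].
  move: dlt; rewrite (eq_bigr (fun i : 'I_n => (i != 0 :> nat) : nat)); last first.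
    by move=> i _; have := all1 i; case: (_ != _) => //= ->.
  have n0 : 0 < n by lia.
  rewrite (bigD1 (Ordinal n0)) //= add0n (eq_bigr (fun=> 1)).
    by rewrite sum1_card cardC1 card_ord ltnn.
  by move=> i; rewrite -val_eqE /= => ->.
rewrite negb_forall => /existsP[i]; rewrite negb_imply => /andP[i0 nE].
by exists i; split=> //; lia.
Qed.

(** With [p] at rank [0], a non-neighbour [m] lies between successive neighbours [a] and [c].
    Flipping [ac] joins [p] to the apex [b] on its far side. *)
Lemma degree_increase T p : triangulation v T -> degree T p < n.-1 ->
  exists2 T', flip_adj v T T' & degree T' p = (degree T p).+1.
Proof.
move=> tT; have [s cs <-] := cyclic_order_at p => dlt.
have [n2 per inj _] := cs.
have [m [m0 mn nE]] := degree_lt_missing cs dlt.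
have nc := triangulation_nc cs tT.
pose P a := [&& 0 < a, a < m & chord s T 0 a].
have exP : exists a, P a.
  exists 1; have E1 := triangulation_side cs tT (i := 0) ltac:(lia).
  rewrite /P E1 andbT /=; have [//|m1] := ltnP 1 m.
  by case/negP: nE; have -> : m = 1 by lia.
have ubP a : P a -> a <= m by case/and3P=> _ /ltnW.
case: (ex_maxnP exP ubP) => a /and3P[a0 am Ea] maxa.
pose Q c := [&& m < c, c < n & chord s T 0 c].
have exQ : exists c, Q c.
  exists n.-1; have Et := triangulation_top cs tT.
  rewrite /Q Et andbT; apply/andP; split; last lia.
  have [//|m1] := ltnP m n.-1.
  by case/negP: nE; have -> : m = n.-1 by lia.
case: (ex_minnP exQ) => c /and3P[mc cn Ec] minc.
(* A chord crossing [ac] would cross [0a] or [0c], or join rank [0] to a rank strictly between [a]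
   and [c]. *)
have Eac : chord s T a c.
  apply: (triangulation_mem cs tT); [lia|lia|] => k l kl ln Ekl.
  apply/negP; rewrite /interleaved => H.
  have [/andP[/andP[ak kc] cl]|/andP[/andP[ka al] lc]] := orP H.
    by apply: (nc 0 k c l) => //; lia.
  have [k0|k0] := posnP k.
    rewrite k0 in Ekl.
    have [lm|ml|lm] := ltngtP l m.
    - by have := maxa l; rewrite /P Ekl; lia.
    - by have := minc l; rewrite /Q Ekl; lia.
    - by move: nE; rewrite -lm Ekl.
  by apply: (nc 0 k a l) => //; lia.
have [b [ab bc Eab Ebc]] := triangulation_split cs tT (i := a) (j := c) ltac:(lia) cn Eac.
(* Rotating by one moves [p] to rank [n - 1], so that [ac] joins the first and third corners, as
   [quad_flip_adj] requires. *)
have cs1 := cyclic_orderS cs.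
pose s1 i := s i.+1.
have sn : s1 n.-1 = s 0 by rewrite /s1 prednK; [rewrite -(per 0) add0n|lia].
have s1p i : 0 < i -> s1 i.-1 = s i by move=> i0; rewrite /s1 prednK.
have F := @quad_flip_adj R n v s1 cs1 T a.-1 b.-1 c.-1 n.-1 tT
  ltac:(lia) ltac:(lia) ltac:(lia) ltac:(lia).
have [b0 c0 bn] : [/\ 0 < b, 0 < c & b < n] by split; clear - a0 ab bc cn; lia.
move: F; rewrite /chord !sn !s1p //.
rewrite !(finset.setUC [set s _] [set s 0])%SET => F.
exists ([set s 0; s b] |: (T :\ [set s a; s c]))%SET.
  by apply: F.
rewrite !(degree_chord _ cs).
rewrite (bigD1 (Ordinal bn)) //= [in RHS](bigD1 (Ordinal bn)) //=.
have -> : chord s T 0 b = false.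
  by apply/negP => E0b; apply: (nc 0 a b c).
rewrite andbF add0n -add1n; congr (_ + _).
  by rewrite /chord finset.setU11 andbT -lt0n b0.
apply: eq_bigr => i; rewrite -val_eqE /= => ib.
have [//|i0] := eqVneq (i : nat) 0.
rewrite /chord in_setU1 in_setD1 !(edge_ranks_eq cs) ?lt0n //; try by clear - ab bc; lia.
have -> : (0 == a) = false by clear - a0; lia.
by rewrite (negPf ib).
Qed.

(** Both are the fan at [p]: with [p] at rank [0], any chord [ij] that avoids [p] and is not a side
    crosses the chord from [0] to [i + 1]. *)
Lemma full_degree_uniq T T' p : triangulation v T -> triangulation v T' ->
  degree T p = n.-1 -> degree T' p = n.-1 -> T = T'.
Proof.
have [s cs <-] := cyclic_order_at p.
have full A : degree A (s 0) = n.-1 -> forall m, 0 < m -> m < n -> chord s A 0 m.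
  rewrite (degree_chord _ cs) => dA m m0 mn; apply/negPn/negP => nE.
  have [n2 _ _ _] := cs; have n0 : 0 < n by lia.
  move: dA; rewrite (bigD1 (Ordinal n0)) //= add0n (bigD1 (Ordinal mn)) /=; last first.
    by rewrite -val_eqE /=; lia.
  rewrite (negPf nE) andbF add0n => dA.
  suff : n.-1 <= n.-2 by lia.
  rewrite -{1}dA; apply: (@leq_trans (\sum_(i < n | (i != Ordinal n0) && (i != Ordinal mn)) 1)).
    by apply: leq_sum => i _; case: (_ && _).
  rewrite sum1_card; have := cardC [set Ordinal n0; Ordinal mn]%SET.
  rewrite cards2 card_ord; have -> : Ordinal n0 != Ordinal mn by rewrite -val_eqE /=; lia.
  have -> : #|[predC [set Ordinal n0; Ordinal mn]%SET]| =
    #|(fun i : 'I_n => (i != Ordinal n0) && (i != Ordinal mn))|.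
    by apply: eq_card => i; rewrite !inE negb_or.
  by move: #|_| => c /=; lia.
move=> tT tT' /full fT /full fT'.
have sub A B : triangulation v A -> triangulation v B ->
    (forall m, 0 < m -> m < n -> chord s A 0 m) ->
    (forall m, 0 < m -> m < n -> chord s B 0 m) -> A \subset B.
  move=> tA tB fA fB; apply/fintype.subsetP => e eA.
  have [i [j [ij jn ee]]] := edge_ranks cs (proj1 (proj1 tA) _ eA).
  rewrite ee; have [i0|i0] := posnP i; first by rewrite i0; apply: fB => //; lia.
  have [->|ji] := eqVneq j i.+1; first by apply: (triangulation_side cs tB); lia.
  exfalso; apply: (triangulation_nc cs tA (i := 0) (j := i) (k := i.+1) (l := j)) => //.
  - lia.
  - by apply: fA => //; lia.
  - by rewrite /chord -ee.
by apply/eqP; rewrite finset.eqEsubset !sub.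
Qed.

Lemma walk_to_full_degree T p : triangulation v T ->
  exists F, [/\ triangulation v F, degree F p = n.-1 &
    walk (flip_adj v) (n.-1 - degree T p) T F].
Proof.
move: {2}(n.-1 - degree T p) (erefl (n.-1 - degree T p)) => d.
elim: d T => [|d IHd] T ed tT.
  exists T; split=> //; last by rewrite ed.
  by have := degree_le T p; lia.
have [|T1 f1 d1] := @degree_increase T p tT; first lia.
have tT1 : triangulation v T1 by case: f1.
have [F [tF dF w]] := IHd T1 ltac:(lia) tT1.
exists F; split=> //; rewrite ed /=; exists T1 => //.
by have -> : d = n.-1 - degree T1 p by lia.
Qed.

Lemma flip_distance_le T T' : 12 < n -> triangulation v T -> triangulation v T' ->
  exists2 k, walk (flip_adj v) k T T' & k <= 2 * n - 10.
Proof.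
move=> n12 tT tT'.
(* The degrees add up to [8n - 12], which exceeds [7n] exactly when [n > 12]. The two walks then
   have total length at most [2 (n - 1) - 8]. *)
have [p hp] : exists p, 8 <= degree T p + degree T' p.
  apply: contrapT => /forallNP H.
  have : \sum_p (degree T p + degree T' p) <= \sum_(p < n) 7.
    by apply: leq_sum => p _; rewrite leqNgt; apply/negP/H.
  rewrite big_split /= !degree_sum // sum_nat_const card_ord; lia.
have [F [tF dF w]] := walk_to_full_degree p tT.
have [F' [tF' dF' w']] := walk_to_full_degree p tT'.
rewrite -(full_degree_uniq tF tF' dF dF') in w'.
exists (n.-1 - degree T p + (n.-1 - degree T' p)).
  by apply: walk_cat w _; apply: walk_sym w' => *; apply: flip_adj_sym.
by have := degree_le T p; have := degree_le T' p; lia.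
Qed.

Lemma flip_graph_diameter : 12 < n ->
  graph_diameter (triangulation v) (flip_adj v) (2 * n - 10).
Proof.
move=> n12.
have up T T' : triangulation v T -> triangulation v T' ->
    exists2 k, graph_dist (flip_adj v) T T' k & k <= 2 * n - 10.
  move=> tT tT'; have [k w kn] := flip_distance_le n12 tT tT'.
  have [m dm mk] := graph_dist_ex w.
  by exists m => //; apply: leq_trans kn.
split=> //; have [T [T' [tT tT' low]]] := zigzag_distance cs0 n12.
exists T, T'; split=> //; have [k dk kn] := up _ _ tT tT'.
have := low k (proj1 dk); rewrite leq_eqVlt => /orP[/eqP -> //|].
by rewrite ltnNge kn.
Qed.

End UpperBound.

(** * Points in convex position *)

Section Hulls.
Local Open Scope ring_scope.
Local Open Scope classical_set_scope.
Variables (R : realType) (m : nat).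
Implicit Types (A : set 'rV[R]_m) (x y : 'rV[R]_m) (c : 'cV[R]_m).

Definition functional c x : R := (x *m c) 0 0.

Lemma functional_sum c k (p : 'I_k -> 'rV[R]_m) (w : 'I_k -> R) :
  functional c (\sum_i w i *: p i) = \sum_i w i * functional c (p i).
Proof.
rewrite /functional mulmx_suml summxE; apply: eq_bigr => i _.
by rewrite -scalemxAl mxE.
Qed.

Lemma conv_hull_le A c b x : (forall y, A y -> functional c y <= b) ->
  conv_hull A x -> functional c x <= b.
Proof.
move=> Ab [k [p [w [Ap w0 w1 ->]]]].
rewrite functional_sum -[leRHS]mul1r -w1 mulr_suml.
by apply: ler_sum => i _; rewrite ler_wpM2l // Ab.
Qed.

Lemma functionalN c x : functional (- c) x = - functional c x.
Proof. by rewrite /functional mulmxN mxE. Qed.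

Lemma conv_hull_ge A c b x : (forall y, A y -> b <= functional c y) ->
  conv_hull A x -> b <= functional c x.
Proof.
move=> Ab /(@conv_hull_le A (- c) (- b)); rewrite functionalN lerN2; apply.
by move=> y /Ab; rewrite functionalN lerN2.
Qed.

Lemma conv_hull_mem A x : A x -> conv_hull A x.
Proof.
move=> Ax; exists 1, (fun=> x), (fun=> 1).
by split=> //; rewrite big_ord1 ?scale1r.
Qed.

Lemma conv_hull3 A (a b c : 'rV[R]_m) (al be ga : R) : A a -> A b -> A c ->
  0 <= al -> 0 <= be -> 0 <= ga -> al + be + ga = 1 ->
  conv_hull A (al *: a + be *: b + ga *: c).
Proof.
move=> Aa Ab Ac al0 be0 ga0 sum1.
exists 3, (fun i => nth c [:: a; b] i), (fun i => nth ga [:: al; be] i).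
split; [by case=> -[|[|[]]]|by case=> -[|[|[]]]| |].
- by rewrite !big_ord_recr big_ord0 /= add0r.
- by rewrite !big_ord_recr big_ord0 /= add0r.
Qed.

End Hulls.

(** * Orientations of triples of points in the plane *)

Section ConvexPosition.
Local Open Scope ring_scope.
Local Open Scope classical_set_scope.
Variable R : realType.
Implicit Types a b c d x y : 'rV[R]_2.

(** Twice the signed area of the triangle [abc], positive when it is counterclockwise. *)
Definition orient a b c : R :=
  (b 0 0 - a 0 0) * (c 0 1 - a 0 1) - (b 0 1 - a 0 1) * (c 0 0 - a 0 0).

Lemma ord2_ind (P : 'I_2 -> Prop) : P 0 -> P 1 -> forall r, P r.
Proof.
move=> P0 P1 [[|[|//]] r2].
- by rewrite (_ : Ordinal r2 = 0) //; apply: val_inj.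
- by rewrite (_ : Ordinal r2 = 1) //; apply: val_inj.
Qed.

Lemma row2P x y : x 0 0 = y 0 0 -> x 0 1 = y 0 1 -> x = y.
Proof. by move=> e0 e1; apply/rowP; apply: ord2_ind. Qed.

Lemma orient_functional a b : exists f : 'cV[R]_2, forall x,
  functional f x - functional f a = orient a b x.
Proof.
exists (\col_i (if i == 0 then a 0 1 - b 0 1 else b 0 0 - a 0 0)) => x.
have l1 : lift ord0 ord0 = 1 :> 'I_2 by apply: val_inj.
have o0 : ord0 = 0 :> 'I_2 by apply: val_inj.
rewrite /functional /orient !mxE !big_ord_recl !big_ord0 !mxE l1 o0 /=.
by ring.
Qed.

(** The affine function [orient a b] vanishes on the first hull and is positive on the second. *)
Lemma conv_hull_separated a b c d (A B : set 'rV[R]_2) :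
  (forall y, A y -> y = a \/ y = b) -> (forall y, B y -> y = c \/ y = d) ->
  0 < orient a b c -> 0 < orient a b d -> ~ (conv_hull A `&` conv_hull B !=set0).
Proof.
move=> Aab Bcd oc od [x [Ax Bx]].
have [f fE] := orient_functional a b.
have xa : functional f x <= functional f a.
  apply: conv_hull_le Ax => y /Aab[->//|->].
  by rewrite -subr_le0 fE /orient le_eqVlt; apply/orP; left; apply/eqP; ring.
have : functional f a + Num.min (orient a b c) (orient a b d) <= functional f x.
  apply: conv_hull_ge Bx => y /Bcd[->|->]; rewrite -lerBrDl fE ge_min lexx ?orbT //.
by move=> /le_trans/(_ xa); rewrite gerDl leNgt lt_min oc od.
Qed.

(** The common point is explicit: on its diagonal, each corner is weighted by the area of the
    triangle of the other three corners, divided by the total area [S]. *)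
Lemma conv_hull_crossing a b c d (A B : set 'rV[R]_2) :
  A a -> A c -> B b -> B d ->
  0 < orient a b c -> 0 < orient a c d -> 0 < orient a b d -> 0 < orient b c d ->
  conv_hull A `&` conv_hull B !=set0.
Proof.
move=> Aa Ac Bb Bd abc acd abd bcd.
pose S := orient b c d + orient a b d.
have S0 : 0 < S by rewrite addr_gt0.
have SE : S = orient a c d + orient a b c by rewrite /S /orient; ring.
exists ((orient b c d / S) *: a + (orient a b d / S) *: c + 0 *: c); split.
  apply: conv_hull3 => //; rewrite ?divr_ge0 // ?ltW //.
  by rewrite addr0 -mulrDl divff // gt_eqF.
have -> : (orient b c d / S) *: a + (orient a b d / S) *: c + 0 *: c =
          (orient a c d / S) *: b + (orient a b c / S) *: d + 0 *: d.
  by apply: row2P; rewrite !mxE /orient; ring.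
apply: conv_hull3 => //; rewrite ?divr_ge0 // ?ltW //.
by rewrite addr0 -mulrDl -SE divff // gt_eqF.
Qed.

(** * Sorting the vertices of a convex polygon by angle *)

Section Polygon.
Variables (n : nat) (v : 'I_n -> 'rV[R]_2).
Hypothesis cv : convex_polygon v.
Implicit Types i j k o : 'I_n.

(** Convexity in homogeneous form, so that polynomial identities between orientations apply without
    division. *)
Lemma convex_polygon_comb i j k o (al be ga : R) : j != i -> k != i -> o != i ->
  0 <= al -> 0 <= be -> 0 <= ga -> 0 < al + be + ga ->
  (forall t, (al + be + ga) * v i 0 t = al * v j 0 t + be * v k 0 t + ga * v o 0 t) ->
  False.
Proof.
move=> ji ki oi al0 be0 ga0 S0 H; case: cv => _ /(_ i); apply.
set S := al + be + ga in S0 H.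
have mem j' : j' != i -> (v @` [set y | y <> i]) (v j') by exists j' => //=; apply/eqP.
have -> : v i = (al / S) *: v j + (be / S) *: v k + (ga / S) *: v o.
  have Sn : S != 0 by rewrite gt_eqF.
  apply/rowP => t; rewrite !mxE; apply: (mulfI Sn).
  by rewrite H; field.
apply: conv_hull3; try exact: mem; rewrite ?divr_ge0 // ?ltW //.
by rewrite -!mulrDl divff // gt_eqF.
Qed.

(** Of three collinear points one lies between the others; the parameter [t] of [v k] on the line
    from [v i] to [v j] tells which. *)
Lemma orient_neq0 i j k : i != j -> j != k -> i != k -> orient (v i) (v j) (v k) != 0.
Proof.
move=> ij jk ik; apply/eqP => o0.
have [ji kj ki] : [/\ j != i, k != j & k != i] by rewrite !(eq_sym k) eq_sym.
have [t tE] : exists t, forall r, v k 0 r = v i 0 r + t * (v j 0 r - v i 0 r).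
  move: o0; rewrite /orient => o0.
  have [e0|n0] := eqVneq (v j 0 0) (v i 0 0).
    have [e1|n1] := eqVneq (v j 0 1) (v i 0 1).
      exfalso; apply: (@convex_polygon_comb j i i i 1 0 0) => //; try lra.
      by apply: ord2_ind; rewrite ?e0 ?e1; ring.
    exists ((v k 0 1 - v i 0 1) / (v j 0 1 - v i 0 1)).
    have d1 : v j 0 1 - v i 0 1 != 0 by rewrite subr_eq0.
    apply: ord2_ind; last by field.
    move: o0; rewrite e0 subrr mul0r sub0r mulr0 addr0 => /eqP.
    by rewrite oppr_eq0 mulf_eq0 (negPf d1) /= subr_eq0 => /eqP.
  exists ((v k 0 0 - v i 0 0) / (v j 0 0 - v i 0 0)).
  have d0 : v j 0 0 - v i 0 0 != 0 by rewrite subr_eq0.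
  apply: ord2_ind; first by field.
  apply: (mulfI d0); rewrite mulrDr mulrA [_ * (_ / _)]mulrCA divff // mulr1.
  lra.
have [tn|tp] := ltP t 0.
  apply: (@convex_polygon_comb i k j j 1 (- t) 0) => //; try lra.
  by move=> r; rewrite tE; ring.
have [t1|t1] := ltP 1 t.
  apply: (@convex_polygon_comb j k i i 1 (t - 1) 0) => //; try lra.
  by move=> r; rewrite tE; ring.
apply: (@convex_polygon_comb k i j j (1 - t) t 0) => //; try lra.
by move=> r; rewrite tE; ring.
Qed.

Lemma orientCr a b c : orient a c b = - orient a b c.
Proof. by rewrite /orient; ring. Qed.

Lemma orient_cycle a b c : orient b c a = orient a b c.
Proof. by rewrite /orient; ring. Qed.

(** Otherwise [v o] would lie in the triangle of the other three points, with the three areas as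
    barycentric weights. *)
Lemma orient_trans o i j k : uniq [:: o; i; j; k] ->
  0 < orient (v o) (v i) (v j) -> 0 < orient (v o) (v j) (v k) ->
  0 < orient (v o) (v i) (v k).
Proof.
rewrite /= !inE !negb_or -!andbA => /and5P[oi oj ok ij /and3P[ik jk _]] p1 p2.
have nz : orient (v o) (v i) (v k) != 0 by apply: orient_neq0.
rewrite lt_neqAle eq_sym nz /= leNgt; apply/negP => p3.
apply: (@convex_polygon_comb o i j k (orient (v o) (v j) (v k))
  (- orient (v o) (v i) (v k)) (orient (v o) (v i) (v j))) => //; try lra; try by rewrite eq_sym.
by apply: ord2_ind; rewrite /orient; ring.
Qed.

(** Otherwise [v j] would lie in the triangle of the other three points. *)
Lemma orient_fan o i j k : uniq [:: o; i; j; k] ->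
  0 < orient (v o) (v i) (v j) -> 0 < orient (v o) (v j) (v k) ->
  0 < orient (v o) (v i) (v k) -> 0 < orient (v i) (v j) (v k).
Proof.
rewrite /= !inE !negb_or -!andbA => /and5P[oi oj ok ij /and3P[ik jk _]] p1 p2 p3.
have nz : orient (v i) (v j) (v k) != 0 by apply: orient_neq0.
rewrite lt_neqAle eq_sym nz /= leNgt; apply/negP => p4.
apply: (@convex_polygon_comb j i k o (orient (v o) (v j) (v k))
  (orient (v o) (v i) (v j)) (- orient (v i) (v j) (v k))) => //; try lra; try by rewrite eq_sym.
by apply: ord2_ind; rewrite /orient; ring.
Qed.

Definition ccw_le o i j : bool :=
  [|| i == o, i == j | (j != o) && (0 < orient (v o) (v i) (v j))].

Lemma ccw_le_total o : total (ccw_le o).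
Proof.
move=> i j; rewrite /ccw_le.
have [//|io] := eqVneq i o; have [|jo] := eqVneq j o; first by rewrite orbT.
have [//|ij] /= := eqVneq i j.
have : orient (v o) (v i) (v j) != 0 by apply: orient_neq0; rewrite // eq_sym.
rewrite (orientCr _ (v i)) oppr_gt0 /=.
by case: ltgtP.
Qed.

Lemma ccw_le_trans o : transitive (ccw_le o).
Proof.
move=> j i k; rewrite /ccw_le.
have [//|io] /= := eqVneq i o.
have [<-|ij] /= := eqVneq i j; first by rewrite (negPf io).
move=> /andP[jo oij]; rewrite (negPf jo) /=.
have [<-|jk] /= := eqVneq j k; first by rewrite jo oij orbT.
move=> /andP[ko ojk]; have [//|ik] /= := eqVneq i k.
rewrite ko; apply: orient_trans oij ojk.
by rewrite /= !inE !negb_or ![o == _]eq_sym io jo ko ij ik jk.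
Qed.

Lemma cyclic_order_ex : exists s, cyclic_order v s.
Proof.
have [n2 _] := cv; have n0 : (0 < n)%N by lia.
pose o := Ordinal n0; pose L := sort (ccw_le o) (enum 'I_n).
have sL : size L = n by rewrite size_sort size_enum_ord.
have uL : uniq L by rewrite sort_uniq enum_uniq.
have srt : sorted (ccw_le o) L by apply: sort_sorted; apply: ccw_le_total.
pose s (i : nat) := nth o L (i %% n).
have sE (i : nat) : (i < n)%N -> s i = nth o L i by move=> ni; rewrite /s modn_small.
have s_inj (i j : nat) : (i < n)%N -> (j < n)%N -> s i = s j -> i = j.
  by move=> ni nj; rewrite !sE // => /eqP; rewrite nth_uniq ?sL // => /eqP.
have s_neq (i j : nat) : (i < n)%N -> (j < n)%N -> i != j -> s i != s j.
  by move=> ni nj; apply: contra => /eqP/s_inj-> //.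
have s_le (i j : nat) : (i < j)%N -> (j < n)%N -> ccw_le o (s i) (s j).
  move=> ij jn; rewrite !sE //; last by apply: ltn_trans jn.
  by apply: (sorted_ltn_nth (@ccw_le_trans o)) => //; rewrite inE sL; lia.
(* Triples in sorted order are counterclockwise: directly if the first vertex is [o], and by
   [orient_fan] otherwise. *)
have ccw (i j k : nat) : (i < j)%N -> (j < k)%N -> (k < n)%N ->
    0 < orient (v (s i)) (v (s j)) (v (s k)).
  move=> ij jk kn.
  have nij : s i != s j by apply: s_neq; lia.
  have njk : s j != s k by apply: s_neq; lia.
  have nik : s i != s k by apply: s_neq; lia.
  have := s_le i j ij ltac:(lia); have := s_le j k jk kn.
  have := s_le i k ltac:(lia) kn.
  rewrite /ccw_le (negPf nij) (negPf njk) (negPf nik) /=.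
  have [io|nio] /= := eqVneq (s i) o.
    by rewrite -io [s j == _]eq_sym (negPf nij) /= => _ /andP[_ ->].
  move=> /andP[ko oik]; have [jo|jo] /= := eqVneq (s j) o; first by [].
  move=> /andP[_ ojk] oij; apply: orient_fan oij ojk oik.
  by rewrite /= !inE !negb_or ![o == _]eq_sym nio jo ko nij nik njk.
have mem i j y : (v @` [set` [set i; j]%SET]) y -> y = v i \/ y = v j.
  by move=> [x /=]; rewrite !inE => /orP[/eqP ->|/eqP ->] <-; [left|right].
have meml i j : (v @` [set` [set i; j]%SET]) (v i).
  by exists i => //=; rewrite !inE eqxx.
have memr i j : (v @` [set` [set i; j]%SET]) (v j).
  by exists j => //=; rewrite !inE eqxx orbT.
have isE (i j : nat) : (i < j)%N -> (j < n)%N -> is_edge [set s i; s j]%SET.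
  by move=> ij jn; rewrite /is_edge cards2 s_neq //; lia.
have cross (i j k l : nat) : (i < k)%N -> (k < j)%N -> (j < l)%N -> (l < n)%N ->
    crossing v [set s i; s j]%SET [set s k; s l]%SET.
  move=> ik kj jl ln; split; [apply: isE; lia|apply: isE; lia| |].
    apply/finset.setP => x; rewrite !inE; apply/negP.
    case/andP=> /orP[/eqP ->|/eqP ->] /orP[/eqP/s_inj H|/eqP/s_inj H];
      have := H ltac:(lia) ltac:(lia); lia.
  apply: (conv_hull_crossing (meml _ _) (memr _ _) (meml _ _) (memr _ _));
    apply: ccw; lia.
exists s; split=> //.
  by move=> i; rewrite /s modnDr.
move=> i j k l ij jn kl ln; split; last first.
  move=> /orP[/andP[/andP[ik kj] jl]|/andP[/andP[ki il] lj]].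
    exact: cross.
  by apply: crossingC; apply: cross.
case=> _ _ /finset.setP dis int; apply/negPn/negP => nint.
have ne (x y : nat) : (x == i) || (x == j) -> (y == k) || (y == l) -> x != y.
  move=> hx hy; apply/eqP => exy; have := dis (s x); rewrite !inE.
  by case/orP: hx => /eqP ex; case/orP: hy => /eqP ey; subst; rewrite ?eqxx ?orbT //=;
    rewrite -?ey -?exy ?eqxx ?orbT.
have [ik il jk jl] : [/\ i != k, i != l, j != k & j != l].
  by split; apply: ne; rewrite eqxx ?orbT.
move: int; rewrite -/(_ !=set0).
(* Chords that do not interleave are apart or nested in rank. In each case one of them, suitably
   directed, has both ends of the other strictly on its left. *)
have : (j < k)%N || (l < i)%N || (i < k)%N && (l < j)%N || (k < i)%N && (j < l)%N.
  by move: nint; rewrite /interleaved; lia.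
move=> /orP[/orP[/orP[c|c]|/andP[c c']]|/andP[c c']].
- by apply: (conv_hull_separated (mem _ _) (mem _ _)); apply: ccw; lia.
- rewrite setIC; apply: (conv_hull_separated (mem _ _) (mem _ _)); apply: ccw; lia.
- rewrite (finset.setUC [set s i]%SET).
  apply: (conv_hull_separated (mem _ _) (mem _ _));
    rewrite -orient_cycle; apply: ccw; lia.
- rewrite setIC (finset.setUC [set s k]%SET).
  apply: (conv_hull_separated (mem _ _) (mem _ _));
    rewrite -orient_cycle; apply: ccw; lia.
Qed.

End Polygon.
End ConvexPosition.

(** * Faces of polytopes *)

Section PolytopeFaces.
Local Open Scope ring_scope.
Local Open Scope classical_set_scope.
Variables (R : realType) (m : nat).
Implicit Types (A P F G : set 'rV[R]_m) (x y z : 'rV[R]_m) (c : 'cV[R]_m).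

Lemma functionalD c c' x : functional (c + c') x = functional c x + functional c' x.
Proof. by rewrite /functional mulmxDr mxE. Qed.

Lemma functionalZ a c x : functional (a *: c) x = a * functional c x.
Proof. by rewrite /functional -scalemxAr mxE. Qed.

Lemma functional_coord t x : functional (delta_mx t 0) x = x 0 t.
Proof.
rewrite /functional mxE (bigD1 t) //= mxE !eqxx mulr1 big1 ?addr0 // => j jt.
by rewrite mxE (negPf jt) mulr0.
Qed.

Lemma functional_segment c x y (l : R) :
  functional c ((1 - l) *: x + l *: y) = (1 - l) * functional c x + l * functional c y.
Proof. by rewrite /functional mulmxDl mxE -!scalemxAl !mxE. Qed.

(** The nonnegative terms [w i * (b - functional c (p i))] sum to zero, so only points on the
    hyperplane carry weight; points of weight zero are replaced by such a point. *)
Lemma conv_hull_face A c b x : (forall y, A y -> functional c y <= b) ->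
  conv_hull A x -> functional c x = b ->
  conv_hull (A `&` [set y | functional c y = b]) x.
Proof.
move=> Ab [k [p [w [Ap w0 w1 ->]]]]; rewrite functional_sum => sb.
have eq0 i : w i * (b - functional c (p i)) = 0.
  have nn j : true -> 0 <= w j * (b - functional c (p j)).
    by move=> _; rewrite mulr_ge0 // subr_ge0 Ab.
  have : \sum_j w j * (b - functional c (p j)) = 0.
    under eq_bigr do rewrite mulrBr.
    by rewrite sumrB sb -mulr_suml w1 mul1r subrr.
  by move/(psumr_eq0P nn)/(_ i); apply.
have [i0 wi0] : exists i, w i != 0.
  apply: contrapT => /forallNP H; have := oner_neq0 R; rewrite -w1 big1 ?eqxx // => i _.
  by apply/eqP/negPn/negP/H.
exists k, (fun i => if w i == 0 then p i0 else p i), w; split=> //.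
- have fE i : w i != 0 -> functional c (p i) = b.
    move=> wi; have /eqP := eq0 i; rewrite mulf_eq0 (negPf wi) /= subr_eq0.
    by move=> /eqP.
  by move=> i; case: ifPn => wi; split=> //=; apply: fE.
- by apply: eq_bigr => i _; case: eqP => [->|//]; rewrite !scale0r.
Qed.

Lemma conv_hull_pair x y z : conv_hull [set x; y] z ->
  exists2 l : R, 0 <= l <= 1 & z = (1 - l) *: x + l *: y.
Proof.
move=> [k [p [w [pxy w0 w1 ->]]]].
exists (\sum_(i | p i == y) w i).
  rewrite sumr_ge0 //= -w1 [leRHS](bigID (fun i => p i == y)) /= lerDl.
  exact: sumr_ge0.
have -> : 1 - \sum_(i | p i == y) w i = \sum_(i | p i != y) w i.
  by rewrite -w1 (bigID (fun i => p i == y)) /= [X in X - _]addrC addrK.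
rewrite (bigID (fun i => p i == y)) /= addrC !scaler_suml.
congr (_ + _); apply: eq_bigr => i; last by move=> /eqP ->.
by case: (pxy i) => /= ->; rewrite ?eqxx.
Qed.

Lemma conv_hull_segment A x y (l : R) : conv_hull A x -> conv_hull A y ->
  0 <= l <= 1 -> conv_hull A ((1 - l) *: x + l *: y).
Proof.
move=> [k [p [w [Ap w0 w1 ->]]]] [k' [p' [w' [Ap' w0' w1' ->]]]] /andP[l0 l1].
exists (k + k')%N,
  (fun i => match split i with inl a => p a | inr b => p' b end),
  (fun i => match split i with inl a => (1 - l) * w a | inr b => l * w' b end).
split.
- by move=> i; case: (split i).
- by move=> i; case: (split i) => a; rewrite mulr_ge0 // subr_ge0.
- rewrite big_split_ord /=.
  under eq_bigr => i _ do rewrite (unsplitK (inl i)).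
  under [X in _ + X]eq_bigr => i _ do rewrite (unsplitK (inr i)).
  by rewrite -!mulr_sumr w1 w1' !mulr1 subrK.
- rewrite big_split_ord /=.
  under [X in _ = X + _]eq_bigr => i _ do rewrite (unsplitK (inl i)) -scalerA.
  under [X in _ = _ + X]eq_bigr => i _ do rewrite (unsplitK (inr i)) -scalerA.
  by rewrite -!scaler_sumr.
Qed.

Lemma seq_argmax (f : 'rV[R]_m -> R) (s : seq 'rV[R]_m) : s != [::] ->
  exists2 y, y \in s & forall x, x \in s -> f x <= f y.
Proof.
elim: s => // a s IHs _; have [->|/IHs[y ys maxy]] := eqVneq s [::].
  by exists a; rewrite ?mem_head // => x; rewrite inE => /eqP ->.
have [fay|fya] := leP (f a) (f y).
- exists y; first by rewrite inE ys orbT.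
  by move=> x; rewrite inE => /orP[/eqP ->|/maxy].
- exists a; first by rewrite mem_head.
  move=> x; rewrite inE => /orP[/eqP -> //|/maxy fx].
  by apply: le_trans fx (ltW fya).
Qed.

Lemma penalty_ex (f g : 'rV[R]_m -> R) (s : seq 'rV[R]_m) :
  exists K : R, forall x, x \in s -> 0 < g x -> f x < K * g x.
Proof.
elim: s => [|a s [K HK]]; first by exists 0.
have [ga|ga] := ltP 0 (g a); last first.
  exists K => x; rewrite inE => /orP[/eqP ->|/HK //].
  by rewrite ltNge ga.
exists (Num.max K (`|f a| / g a + 1)) => x; rewrite inE => /orP[/eqP -> _|xs gx].
  apply: (@lt_le_trans _ _ ((`|f a| / g a + 1) * g a)).
    rewrite mulrDl mul1r divfK ?gt_eqF //.
    by apply: (le_lt_trans (ler_norm _)); rewrite ltrDl.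
  by rewrite ler_pM2r // le_max lexx orbT.
apply: (lt_le_trans (HK x xs gx)).
by rewrite ler_pM2r // le_max lexx.
Qed.

(** If [c0] defines [F], then [K *: c0 + c] exposes the maximizers of [c] over [F]: for large [K]
    the finitely many generators outside [F] fall below the maximum. *)
Lemma face_argmax P F c : polytope P -> nonempty_face P F ->
  exists b G, [/\ nonempty_face P G, (forall x, F x -> functional c x <= b) &
    G = [set x | F x /\ functional c x = b]].
Proof.
move=> [A finA ->{P}] [[x0 Fx0] [c0 [b0 [P0 FE]]]].
have {}FE : F = [set x | conv_hull A x /\ functional c0 x = b0] by [].
have /finite_seqP[s sA] := finA.
have A0 y : A y -> functional c0 y <= b0.
  by move=> Ay; apply: P0; apply: conv_hull_mem.
have hullF x : F x -> conv_hull (A `&` [set y | functional c0 y = b0]) x.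
  by rewrite FE => -[hx ex]; apply: conv_hull_face.
pose t := [seq y <- s | functional c0 y == b0].
have tP y : A y -> functional c0 y = b0 -> y \in t.
  by rewrite sA /= mem_filter => -> /eqP ->.
have t0 : t != [::].
  have [k [p [w [Ap w0 w1 _]]]] := hullF _ Fx0.
  case: k p w Ap w0 w1 => [p w _ _|k p w Ap _ _].
    by rewrite big_ord0 => /eqP; rewrite eq_sym oner_eq0.
  by have [a1 /(tP _ a1) a2] := Ap ord0; apply/eqP => t0; rewrite t0 in a2.
have [y0 y0t maxy] := seq_argmax (functional c) t0.
have [Ay0 cy0] : A y0 /\ functional c0 y0 = b0.
  by move: y0t; rewrite mem_filter sA => /andP[/eqP].
set b := functional c y0 in maxy.
have [K HK] := penalty_ex (fun x => functional c x - b) (fun x => b0 - functional c0 x) s.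
have dE x : functional (K *: c0 + c) x = K * functional c0 x + functional c x.
  by rewrite functionalD functionalZ.
have Alt y : A y -> functional c0 y != b0 ->
    functional (K *: c0 + c) y < K * b0 + b.
  move=> Ay ne; have := HK y; rewrite {1}sA /= in Ay *.
  move=> /(_ Ay); rewrite subr_gt0 lt_neqAle ne A0 ?sA //= dE => /(_ isT).
  by rewrite mulrBr; lra.
have Ale y : A y -> functional (K *: c0 + c) y <= K * b0 + b.
  move=> Ay; have [e|/(Alt _ Ay)/ltW//] := eqVneq (functional c0 y) b0.
  by rewrite dE e lerD2l; apply: maxy; apply: tP.
have cF x : F x -> functional c x <= b.
  by move=> /hullF; apply: conv_hull_le => y [Ay /= e]; apply: maxy; apply: tP.
exists b, [set x | F x /\ functional c x = b]; split=> //.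
have GE : [set x | F x /\ functional c x = b] =
    [set x | conv_hull A x /\ functional (K *: c0 + c) x = K * b0 + b].
  apply/seteqP; split=> x /=.
    by rewrite FE => -[[hx e0] e1]; split=> //; rewrite dE e0 e1.
  move=> [hx ex]; have hx' := conv_hull_face Ale hx ex.
  have both y : (A `&` [set y | functional (K *: c0 + c) y = K * b0 + b]) y ->
      functional c0 y = b0 /\ functional c y = b.
    move=> [Ay /= e]; have [e0|/(Alt _ Ay)] := eqVneq (functional c0 y) b0.
      by split=> //; move: e; rewrite dE e0 => /addrI.
    by rewrite e ltxx.
  have val c' b' : (forall y, (A `&` [set y | functional (K *: c0 + c) y = K * b0 + b]) y ->
      functional c' y = b') -> functional c' x = b'.
    move=> H; apply/eqP; rewrite eq_le; apply/andP; split.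
      by apply: conv_hull_le hx' => y /H ->.
    by apply: conv_hull_ge hx' => y /H ->.
  rewrite FE /=; split; [split=> //|]; apply: val => y /both[] //.
split; first by exists y0; rewrite FE; split=> //; split=> //; apply: conv_hull_mem.
exists (K *: c0 + c), (K * b0 + b); split=> // x hx.
exact: conv_hull_le hx.
Qed.

(** The maximizers of a coordinate over [F] form a subface, which is [F] by minimality; so every
    coordinate is constant on [F]. *)
Lemma minimal_face_singleton P F : polytope P -> nonempty_face P F ->
  (forall G, nonempty_face P G -> G `<=` F -> G = F) -> exists x, F = [set x].
Proof.
move=> pP fF minF; have [[x0 Fx0] _] := fF; exists x0.
apply/seteqP; split=> [y Fy|y -> //]; apply/rowP => t.
have [b [G [fG _ GE]]] := face_argmax (delta_mx t 0) pP fF.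
have GF : G = F by apply: minF => // z; rewrite GE => -[].
have val z : F z -> z 0 t = b.
  by rewrite -GF GE => -[_]; rewrite functional_coord.
by rewrite !val.
Qed.

(** Every functional attains its maximum over [F] at [x] or [y]. Applied to a functional and its
    opposite, this bounds its values on [F] by those at [x] and [y]. *)
Lemma two_vertex_face P F x y : polytope P -> nonempty_face P F -> x <> y ->
  F x -> F y ->
  (forall G, nonempty_face P G -> G `<=` F -> [\/ G = F, G = [set x] | G = [set y]]) ->
  F = conv_hull [set x; y].
Proof.
move=> pP fF xy Fx Fy sub.
have am c z : F z -> functional c z <= Num.max (functional c x) (functional c y).
  move=> Fz; have [b [G [fG Fb GE]]] := face_argmax c pP fF.
  have GF : G `<=` F by move=> u; rewrite GE => -[].
  have bG u : G u -> functional c u = b by rewrite GE => -[].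
  have [GF'|Gx|Gy] := sub G fG GF.
  - by rewrite !(bG _) ?GF' // le_max lexx.
  - by rewrite le_max (bG x) ?Gx // Fb.
  - by rewrite le_max (bG y) ?Gy // Fb ?orbT.
have bounds c z : F z -> functional c x <= functional c y ->
    functional c x <= functional c z <= functional c y.
  move=> Fz cxy; have := am c z Fz; rewrite max_r // => -> /=; rewrite andbT.
  by have := am (- c) z Fz; rewrite !functionalN max_l ?lerN2.
have [t xyt] : exists t, y 0 t != x 0 t.
  apply: contrapT => /forallNP H; apply: xy; apply/rowP => t.
  by apply/eqP; rewrite eq_sym; apply/negPn/negP/H.
have dt : y 0 t - x 0 t != 0 by rewrite subr_eq0.
pose c := (y 0 t - x 0 t)^-1 *: delta_mx t 0 : 'cV[R]_m.
have cE z : functional c z = (y 0 t - x 0 t)^-1 * z 0 t.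
  by rewrite functionalZ functional_coord.
have c1 : functional c y = functional c x + 1 by rewrite !cE; field.
apply/seteqP; split=> z.
  move=> Fz; pose l := functional c z - functional c x.
  have l01 : 0 <= l <= 1.
    by have := bounds c z Fz; rewrite c1 lerDl ler01 /l => /(_ isT) /andP[? ?]; lra.
  have -> : z = (1 - l) *: x + l *: y.
    apply/rowP => r; rewrite !mxE.
    (* As [c] grows by [1] from [x] to [y], this functional is equal at both ends, hence constant on
       [F]; it yields coordinate [r] of [z] from [l]. *)
    pose cr := delta_mx r 0 - (y 0 r - x 0 r) *: c.
    have crE u : functional cr u = u 0 r - (y 0 r - x 0 r) * functional c u.
      by rewrite functionalD functionalN functionalZ functional_coord.
    have := bounds cr z Fz; rewrite !crE c1 => H.
    suff : z 0 r = x 0 r + (y 0 r - x 0 r) * l by move=> ->; ring.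
    by move: H; rewrite mulrDr /l => /(_ ltac:(lra)) /andP[? ?]; lra.
  by apply: conv_hull_segment => //; apply: conv_hull_mem; [left|right].
move=> /conv_hull_pair[l l01 ->].
case: fF pP => _ [c0 [b0 [_ FE]]] [A _ PE].
have {}FE : F = [set x | P x /\ functional c0 x = b0] by [].
move: Fx Fy; rewrite FE => -[Px ex] [Py ey] /=; split.
  by move: Px Py; rewrite PE; move=> *; apply: conv_hull_segment.
by rewrite functional_segment ex ey; ring.
Qed.

(** The functional defining [G] is affine along the segment and at most [b] there, so it equals [b]
    everywhere, at one end only, or nowhere. *)
Lemma segment_subface P G x y : nonempty_face P (conv_hull [set x; y]) ->
  nonempty_face P G -> G `<=` conv_hull [set x; y] ->
  [\/ G = conv_hull [set x; y], G = [set x] | G = [set y]].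
Proof.
move=> [_ [c0 [b0 [_ SE]]]] [[g Gg] [c [b [Pb GE]]]] GS.
have {}GE : G = [set x | P x /\ functional c x = b] by [].
have SP z : conv_hull [set x; y] z -> P z by rewrite SE => -[].
have Sx : conv_hull [set x; y] x by apply: conv_hull_mem; left.
have Sy : conv_hull [set x; y] y by apply: conv_hull_mem; right.
have xb : functional c x <= b by apply/Pb/SP.
have yb : functional c y <= b by apply/Pb/SP.
have GP z : G z -> exists2 l : R, 0 <= l <= 1 &
    z = (1 - l) *: x + l *: y /\ (1 - l) * functional c x + l * functional c y = b.
  move=> Gz; have [l l01 zE] := conv_hull_pair (GS _ Gz); exists l => //; split=> //.
  by move: Gz; rewrite GE zE => -[_]; rewrite functional_segment.
have [ex|nx] := eqVneq (functional c x) b; have [ey|ny] := eqVneq (functional c y) b.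
- apply: Or31; apply/seteqP; split=> // z Sz; rewrite GE; split; first exact: SP.
  have [l _ ->] := conv_hull_pair Sz.
  by rewrite functional_segment ex ey; ring.
- apply: Or32; have Gx z : G z -> z = x.
    move=> /GP[l /andP[l0 l1] [-> E]]; suff -> : l = 0 by rewrite subr0 scale1r scale0r addr0.
    have lt : functional c y < b by rewrite lt_neqAle ny.
    have : l * (b - functional c y) = 0 by move: E; rewrite ex => E; lra.
    by move/eqP; rewrite mulf_eq0 => /orP[/eqP //|]; rewrite subr_eq0 eq_sym (negPf ny).
  by apply/seteqP; split=> [z /Gx//|z ->]; rewrite -(Gx _ Gg).
- apply: Or33; have Gy z : G z -> z = y.
    move=> /GP[l /andP[l0 l1] [-> E]].
    suff -> : l = 1 by rewrite subrr scale0r scale1r add0r.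
    have : (1 - l) * (b - functional c x) = 0 by move: E; rewrite ey => E; lra.
    move/eqP; rewrite mulf_eq0 => /orP[|]; rewrite subr_eq0 eq_sym; first by move/eqP.
    by rewrite (negPf nx).
  by apply/seteqP; split=> [z /Gy//|z ->]; rewrite -(Gy _ Gg).
- exfalso; have [l /andP[l0 l1] [_ E]] := GP _ Gg.
  have lx : functional c x < b by rewrite lt_neqAle nx.
  have ly : functional c y < b by rewrite lt_neqAle ny.
  move: (functional c x) (functional c y) E lx ly => u w E lx ly.
  have lw : 0 <= l * (b - w) by rewrite mulr_ge0 // subr_ge0 ltW.
  have lu : 0 <= (1 - l) * (b - u) by apply: mulr_ge0; rewrite subr_ge0 // ltW.
  have [l_eq0|l_neq0] := eqVneq l 0; first by move: E; rewrite l_eq0; lra.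
  suff : 0 < l * (b - w) by lra.
  by rewrite mulr_gt0 ?subr_gt0 // lt_neqAle eq_sym l_neq0.
Qed.

End PolytopeFaces.

(** * The graph of the associahedron *)

Section GraphIsomorphism.
Local Open Scope nat_scope.
Variables (S1 S2 : Type) (V1 : set S1) (V2 : set S2).
Variables (adj1 : S1 -> S1 -> Prop) (adj2 : S2 -> S2 -> Prop) (h : S1 -> S2).
Hypotheses (V_adj1 : forall x y, adj1 x y -> V1 y)
  (V_adj2 : forall x y, adj2 x y -> V2 y)
  (hV : forall x, V1 x -> V2 (h x))
  (h_surj : forall y, V2 y -> exists2 x, V1 x & h x = y)
  (h_inj : forall x y, V1 x -> V1 y -> h x = h y -> x = y)
  (h_adj : forall x y, V1 x -> V1 y -> adj1 x y <-> adj2 (h x) (h y)).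

(** Adjacency leads only to vertices, so each intermediate point of a walk has a preimage under
    [h]. *)
Lemma walk_iso k x y : V1 x -> V1 y ->
  walk adj1 k x y <-> walk adj2 k (h x) (h y).
Proof.
move=> + Vy; elim: k x => [|k IHk] x Vx /=.
  by split=> [->|/h_inj]; [|apply].
split=> [[z xz zy]|[z xz zy]].
  have Vz := V_adj1 xz; exists (h z); first exact/h_adj.
  exact/IHk.
have [z' Vz' ez] := h_surj (V_adj2 xz); subst z.
by exists z'; [apply/h_adj|apply/IHk].
Qed.

Lemma graph_diameter_iso D :
  graph_diameter V1 adj1 D -> graph_diameter V2 adj2 D.
Proof.
have dist k x y : V1 x -> V1 y -> graph_dist adj1 x y k -> graph_dist adj2 (h x) (h y) k.
  move=> Vx Vy [w wmin]; split; first exact/walk_iso.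
  by move=> j wj; apply: wmin; apply/walk_iso.
move=> [up [x [y [Vx Vy d]]]]; split.
  move=> _ _ /h_surj[a Va <-] /h_surj[b Vb <-].
  by have [k dk kD] := up a b Va Vb; exists k => //; apply: dist.
by exists (h x), (h y); split; [exact: hV|exact: hV|exact: dist].
Qed.

End GraphIsomorphism.

(** * Triangulations as maximal faces of the complex of interior edges *)

Section InteriorEdges.
Local Open Scope nat_scope.
Variables (R : realType) (n : nat) (v : 'I_n -> 'rV[R]_2).
Implicit Types (T A B C : {set {set 'I_n}}) (e f : {set 'I_n}).
Hypothesis cv : convex_polygon v.

(** Boundary edges belong to every triangulation, so dropping them loses no information. *)
Definition interior_part T : {set {set 'I_n}} :=
  [set e in T | `[< interior_edge v e >]]%SET.

Lemma in_interior_part T e : e \in interior_part T <-> e \in T /\ interior_edge v e.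
Proof. by rewrite inE; split=> [/andP[-> /asboolP]|[-> /asboolP]]. Qed.

Lemma noncrossing_extend A : noncrossing_edges v A ->
  exists2 T, triangulation v T & A \subset T.
Proof.
move=> ncA.
have [T /maxsetP[/asboolP ncT maxT] AT] :=
  @maxset_exists _ (fun B : {set {set 'I_n}} => `[< noncrossing_edges v B >]) A (asboolT ncA).
by exists T => //; split=> // B ncB TB; apply: maxT => //; apply/asboolP.
Qed.

Lemma triangulation_boundary T e : triangulation v T -> is_edge e ->
  ~ interior_edge v e -> e \in T.
Proof.
move=> [[eT ncT] maxT] ee ne; rewrite -(maxT (e |: T)%SET) ?finset.setU11 ?finset.subsetUr //.
have nce f : ~ crossing v e f by move=> cef; apply: ne; split=> //; exists f.
split=> [f|f g]; rewrite !in_setU1; first by case/orP=> [/eqP ->|/eT].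
move=> /orP[/eqP ->|fT]; first by move=> _; apply: nce.
by move=> /orP[/eqP ->|gT]; [move/crossingC; apply: nce|apply: ncT].
Qed.

Lemma interior_part_face T : triangulation v T -> Sigma_face v (interior_part T).
Proof.
move=> [[_ ncT] _]; split=> [e /in_interior_part[]//|e f].
by move=> /in_interior_part[eT _] /in_interior_part[fT _]; apply: ncT.
Qed.

Lemma Sigma_face_sub B C : Sigma_face v C -> B \subset C -> Sigma_face v B.
Proof.
move=> [iC ncC] /fintype.subsetP BC; split=> [e /BC|e f /BC eC /BC fC]; first exact: iC.
exact: ncC.
Qed.

Lemma Sigma_face_extend B : Sigma_face v B ->
  exists2 T, triangulation v T & B \subset interior_part T.
Proof.
move=> [iB ncB]; have [|T tT BT] := @noncrossing_extend B.
  by split=> // e /iB[].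
exists T => //; apply/fintype.subsetP => e eB; apply/in_interior_part.
by split; [apply: (fintype.subsetP BT)|apply: iB].
Qed.

Lemma triangulation_sub T T' : triangulation v T -> triangulation v T' ->
  interior_part T \subset interior_part T' -> T = T'.
Proof.
move=> tT tT' /fintype.subsetP sub; symmetry; apply: (proj2 tT); first by case: tT'.
apply/fintype.subsetP => e eT; have [ie|ne] := pselect (interior_edge v e).
  by have /sub/in_interior_part[] : e \in interior_part T by apply/in_interior_part.
by apply: triangulation_boundary => //; case: tT => -[eT' _] _; apply: eT'.
Qed.

Lemma interior_part_max T B : triangulation v T -> Sigma_face v B ->
  interior_part T \subset B -> B = interior_part T.
Proof.
move=> tT fB sub; have [T' tT' BT'] := Sigma_face_extend fB.
have e : T = T' by apply: triangulation_sub => //; apply: fintype.subset_trans BT'.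
by apply/eqP; rewrite finset.eqEsubset sub andbT e.
Qed.

Lemma flip_inter T T' : flip_adj v T T' ->
  exists e, [/\ e \in T, interior_edge v e & T :&: T' = T :\ e]%SET.
Proof.
move=> [tT tT' [a [b [c [d [acT iac cr _ ->]]]]]].
exists [set a; c]%SET; split=> //; apply/finset.setP => e.
rewrite finset.in_setI in_setU1 in_setD1; have [->|ne] /= := eqVneq e [set b; d]%SET.
  have -> : ([set b; d]%SET \in T) = false.
    by apply/negP => bdT; case: tT => -[_ nc] _; apply: (nc _ _ acT bdT).
  by rewrite andbF.
by rewrite andbCA andbb.
Qed.

Lemma flip_neq T T' : flip_adj v T T' -> T <> T'.
Proof.
move=> /flip_inter[e [eT _ H]] eTT; have : e \in (T :\ e)%SET.
  by rewrite -H -eTT finset.setIid.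
by rewrite in_setD1 eqxx.
Qed.

Lemma flip_two_triangulations T T' A : flip_adj v T T' -> triangulation v A ->
  (T :&: T' \subset A)%SET -> A = T \/ A = T'.
Proof.
move=> fT tA; have [s cs] := cyclic_order_ex cv; have [n2 per _ _] := cs.
have inter (x y : {set 'I_n}) : x \in T -> y \notin T ->
    (T :&: (y |: (T :\ x)) = T :\ x)%SET.
  move=> xT yT; apply/finset.setP => e; rewrite !(finset.in_setI, in_setU1, in_setD1).
  have [->|ne] /= := eqVneq e y; first by rewrite (negPf yT) andbF.
  by rewrite andbCA andbb.
have notin s' (cs' : cyclic_order v s') i j k l : i < j -> j < k -> k < l -> l < n ->
    triangulation v T -> chord s' T i k -> ~~ chord s' T j l.
  move=> ij jk kl ln tT Eik; apply/negP => Ejl.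
  exact: (triangulation_nc cs' tT ij jk kl ln Eik Ejl).
have [tT tT' /(flip_ranks cs)] := fT.
move=> [i [j [k [l [[ij jk kl ln] [[Eij Ejk Ekl Eil] [[Eik eT']|[Ejl eT']]]]]]]].
  rewrite eT' inter //; last exact: (notin s cs i j k l).
  exact: (quad_two_triangulations cs tT ij jk kl ln Eij Ejk Ekl Eil tA).
(* Rotating by [i + 1] sorts the corners as [j], [k], [l], [i], so that the removed diagonal [jl]
   joins the first and third of them. *)
pose s' x := s (x + i.+1).
have cs' : cyclic_order v s' := cyclic_orderD i.+1 cs.
have s'E x : i < x -> s' (x - i.+1) = s x by move=> ix; rewrite /s' subnK.
have s'i : s' n.-1 = s i.
  by rewrite /s' (_ : n.-1 + i.+1 = i + n) ?per //; lia.
have := @quad_two_triangulations R n v s' cs' T (j - i.+1) (k - i.+1) (l - i.+1) n.-1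
  tT ltac:(lia) ltac:(lia) ltac:(lia) ltac:(lia).
have nik := notin s' cs' (j - i.+1) (k - i.+1) (l - i.+1) n.-1
  ltac:(lia) ltac:(lia) ltac:(lia) ltac:(lia) tT.
move: nik; rewrite /chord !s'i !s'E; try lia.
rewrite !(finset.setUC [set s _]%SET [set s i]%SET) => nik.
move=> /(_ Ejk Ekl Eil Eij A tA).
by rewrite eT' inter //; apply: nik.
Qed.

(** An interior edge [xy] has vertices on both sides, hence a triangle on each. The two apexes come
    from splitting after rotating [x], respectively [y], to rank [0]. *)
Lemma flip_ex T e : triangulation v T -> e \in T -> interior_edge v e ->
  exists2 T', flip_adj v T T' & (T :\ e \subset T')%SET.
Proof.
move=> tT eT [ee [f cef]]; have [s cs] := cyclic_order_ex cv.
have [n2 per inj crE] := cs.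
have [x [y [xy yn exy]]] := edge_ranks cs ee.
have [k [l [kl ln fkl]]] : exists k l, [/\ k < l, l < n & f = [set s k; s l]%SET].
  by apply: (edge_ranks cs); case: cef.
move: cef; rewrite exy fkl => /crE-/(_ xy yn kl ln); rewrite /interleaved => itl.
pose s1 z := s (z + x); pose s2 z := s (z + y).
have cs1 : cyclic_order v s1 := cyclic_orderD x cs.
have cs2 : cyclic_order v s2 := cyclic_orderD y cs.
have E1 : chord s1 T 0 (y - x) by rewrite /chord /s1 subnK; [rewrite -exy|lia].
have E2 : chord s2 T 0 (n - (y - x)).
  rewrite /chord /s2 (_ : n - (y - x) + y = x + n); last lia.
  by rewrite per finset.setUC -exy.
have [j [j0 jm F1 F2]] := triangulation_split cs1 tT (i := 0) (j := y - x)
  ltac:(lia) ltac:(lia) E1.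
have [t [t0 tm G1 G2]] := triangulation_split cs2 tT (i := 0) (j := n - (y - x))
  ltac:(lia) ltac:(lia) E2.
have s1t : s1 (t + (y - x)) = s2 t by rewrite /s1 /s2; congr s; lia.
have s1y : s1 (y - x) = s2 0 by rewrite /s1 /s2; congr s; lia.
have s10 : s2 (n - (y - x)) = s1 0.
  by rewrite /s1 /s2 (_ : n - (y - x) + y = 0 + x + n); [rewrite per|lia].
have fl := @quad_flip_adj R n v s1 cs1 T 0 j (y - x) (t + (y - x)) tT j0 jm
  ltac:(lia) ltac:(lia) F1 F2.
exists ([set s1 j; s1 (t + (y - x))] |: (T :\ [set s1 0; s1 (y - x)]))%SET.
  apply: fl; rewrite /chord ?s1t ?s1y //.
  - by rewrite finset.setUC -s10.
  - by rewrite -s1y.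
have <- : e = [set s1 0; s1 (y - x)]%SET by rewrite /s1 subnK; [rewrite add0n|lia].
by rewrite -exy; apply: finset.subsetUr.
Qed.

End InteriorEdges.

(** * Vertices and edges of the associahedron *)

Section AssociahedronGraph.
Local Open Scope classical_set_scope.
Variables (R : realType) (m n : nat) (P : set 'rV[R]_m) (v : 'I_n -> 'rV[R]_2).
Variable phi : {set {set 'I_n}} -> set 'rV[R]_m.
Hypotheses (pP : polytope P) (cv : convex_polygon v).
Hypothesis phi_face : forall A, Sigma_face v A -> nonempty_face P (phi A).
Hypothesis phi_surj : forall F, nonempty_face P F -> exists2 A, Sigma_face v A & phi A = F.
Hypothesis phi_sub : forall A B, Sigma_face v A -> Sigma_face v B ->
  (phi A `<=` phi B <-> B \subset A).
Implicit Types (T : {set {set 'I_n}}).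

Let Int := interior_part v.

Definition triangulation_vertex T : 'rV[R]_m := xget 0%R (phi (Int T)).

(** Triangulations give maximal faces of the complex, which [phi] sends to minimal faces of [P],
    that is, to points. *)
Lemma triangulation_vertexE T : triangulation v T ->
  phi (Int T) = [set triangulation_vertex T].
Proof.
move=> tT; have fT := interior_part_face tT.
have [x ex] : exists x, phi (Int T) = [set x].
  apply: (minimal_face_singleton pP); first exact: phi_face.
  move=> G /phi_surj[B fB <-] /(phi_sub fB fT) sub.
  by rewrite (interior_part_max tT fB sub).
have : phi (Int T) (triangulation_vertex T) by apply: xgetI; rewrite ex.
by rewrite ex => ->.
Qed.

Lemma triangulation_vertex_inj T T' : triangulation v T -> triangulation v T' ->
  triangulation_vertex T = triangulation_vertex T' -> T = T'.
Proof.
move=> tT tT' e; have [fT fT'] := (interior_part_face tT, interior_part_face tT').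
apply: (triangulation_sub tT tT'); apply: (phi_sub fT' fT).1.
by rewrite !triangulation_vertexE // e.
Qed.

Lemma triangulation_vertex_face T : triangulation v T ->
  polytope_vertex P (triangulation_vertex T).
Proof.
move=> tT; rewrite /polytope_vertex -triangulation_vertexE //.
exact/phi_face/interior_part_face.
Qed.

Lemma triangulation_vertex_surj x : polytope_vertex P x ->
  exists2 T, triangulation v T & triangulation_vertex T = x.
Proof.
move=> /phi_surj[B fB eB]; have [T tT BT] := Sigma_face_extend fB; exists T => //.
have /(phi_sub (interior_part_face tT) fB) := BT.
by rewrite eB triangulation_vertexE // => /(_ _ erefl).
Qed.

(** The only faces of the complex containing the common part [B] are [B], [Int T] and [Int T']. So
    the proper subfaces of [phi B] are two vertices, and [phi B] is the segment joining them. *)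
Lemma flip_polytope_adj T T' : flip_adj v T T' ->
  polytope_adj P (triangulation_vertex T) (triangulation_vertex T').
Proof.
move=> fl; have [tT tT' _] := fl.
have [fT fT'] := (interior_part_face tT, interior_part_face tT').
have ne : triangulation_vertex T <> triangulation_vertex T'.
  by move=> /triangulation_vertex_inj e; apply: (flip_neq fl); apply: e.
pose B := (Int T :&: Int T')%SET.
have fB : Sigma_face v B by apply: Sigma_face_sub fT _; apply: finset.subsetIl.
have sT : phi (Int T) `<=` phi B by apply: (phi_sub fT fB).2; apply: finset.subsetIl.
have sT' : phi (Int T') `<=` phi B by apply: (phi_sub fT' fB).2; apply: finset.subsetIr.
(* The intersection misses a single edge of [Int U], so no set lies strictly between the two. *)
have between (U U' C : {set {set 'I_n}}) : flip_adj v U U' ->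
    (Int U :&: Int U' \subset C)%SET -> C \subset Int U ->
    C = (Int U :&: Int U')%SET \/ C = Int U.
  move=> /flip_inter[e [eU ie eUU]] BC CU.
  have sub f : f \in Int U -> f != e -> f \in C.
    move=> /in_interior_part[fU intf] fe; apply: (fintype.subsetP BC).
    have : f \in (U :&: U')%SET by rewrite eUU in_setD1 fe.
    by rewrite !finset.in_setI => /andP[_ fU']; apply/andP; split; apply/in_interior_part.
  have [eC|neC] := boolP (e \in C).
    right; apply/eqP; rewrite finset.eqEsubset CU; apply/fintype.subsetP => f fU.
    by have [->//|] := eqVneq f e; apply: sub.
  left; apply/eqP; rewrite finset.eqEsubset BC andbT; apply/fintype.subsetP => f fC.
  have fU := fintype.subsetP CU _ fC; rewrite finset.in_setI fU /=.
  have [fU1 intf] := (in_interior_part v U f).1 fU; apply/in_interior_part; split=> //.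
  have : f \in (U :&: U')%SET.
    by rewrite eUU in_setD1 fU1 andbT; apply: contraNneq neC => <-.
  by rewrite finset.in_setI => /andP[].
split=> //; [exact: triangulation_vertex_face|exact: triangulation_vertex_face|].
rewrite -(@two_vertex_face _ _ P (phi B) _ _ pP) //.
- exact: phi_face.
- exact: phi_face.
- by apply: sT; rewrite triangulation_vertexE.
- by apply: sT'; rewrite triangulation_vertexE.
move=> G /phi_surj[C fC <-] /(phi_sub fC fB) BC.
have [T1 tT1 CT1] := Sigma_face_extend fC.
have [eT1|eT1] : T1 = T \/ T1 = T'.
  apply: (flip_two_triangulations cv fl tT1); apply/fintype.subsetP => e.
  rewrite finset.in_setI => /andP[eT eT']; have [ie|nie] := pselect (interior_edge v e).
    suff /(fintype.subsetP CT1)/in_interior_part[] : e \in C by [].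
    apply: (fintype.subsetP BC); rewrite finset.in_setI.
    by apply/andP; split; apply/in_interior_part.
  by apply: (triangulation_boundary tT1 _ nie); case: tT => -[eT0 _] _; apply: eT0.
- rewrite eT1 in CT1; have [->|->] := between _ _ _ fl BC CT1; first exact: Or31.
  by apply: Or32; apply: triangulation_vertexE.
- rewrite eT1 in CT1; rewrite /B finset.setIC in BC.
  have [->|->] := between _ _ _ (flip_adj_sym fl) BC CT1.
    by apply: Or31; rewrite finset.setIC.
  by apply: Or33; apply: triangulation_vertexE.
Qed.

(** The segment is some [phi B]. Flipping an edge of [T] outside [B] gives a triangulation still
    containing [B]; its vertex lies on the segment and differs from that of [T], so it is that of
    [T']. *)
Lemma polytope_adj_flip T T' : triangulation v T -> triangulation v T' ->
  polytope_adj P (triangulation_vertex T) (triangulation_vertex T') -> flip_adj v T T'.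
Proof.
move=> tT tT' [_ _ ne fS]; have [B fB eB] := phi_surj fS.
have [fT fT'] := (interior_part_face tT, interior_part_face tT').
have BT : B \subset Int T.
  apply: (phi_sub fT fB).1; rewrite triangulation_vertexE // eB => _ ->.
  by apply: conv_hull_mem; left.
have BT' : B \subset Int T'.
  apply: (phi_sub fT' fB).1; rewrite triangulation_vertexE // eB => _ ->.
  by apply: conv_hull_mem; right.
have [e eT eB'] : exists2 e, e \in Int T & e \notin B.
  apply/fintype.subsetPn/negP => TB; apply: ne; congr triangulation_vertex.
  by apply: (triangulation_sub tT tT'); apply: fintype.subset_trans BT'.
have [eT0 ie] := (in_interior_part v T e).1 eT.
have [T1 fl sub] := flip_ex cv tT eT0 ie.
have tT1 : triangulation v T1 by case: fl.
have BT1 : B \subset Int T1.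
  apply/fintype.subsetP => f fB'.
  have [fT0 intf] := (in_interior_part v T f).1 (fintype.subsetP BT _ fB').
  apply/in_interior_part; split=> //; apply: (fintype.subsetP sub).
  by rewrite in_setD1 fT0 andbT; apply: contraNneq eB' => <-.
have s1 : [set triangulation_vertex T1] `<=`
    conv_hull [set triangulation_vertex T; triangulation_vertex T'].
  by rewrite -triangulation_vertexE // -eB; apply: (phi_sub (interior_part_face tT1) fB).2.
have [e1|e1|e1] := segment_subface fS (triangulation_vertex_face tT1) s1.
- have mem x : [set triangulation_vertex T; triangulation_vertex T'] x ->
      x = triangulation_vertex T1.
    by move=> /conv_hull_mem; rewrite -e1.
  have [e2 e3] := (mem _ (or_introl erefl), mem _ (or_intror erefl)).
  by case: ne; rewrite e2 e3.
- have /triangulation_vertex_inj e2 : triangulation_vertex T1 = triangulation_vertex T.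
    by have : [set triangulation_vertex T1] (triangulation_vertex T1) by []; rewrite e1.
  by case: (flip_neq fl); rewrite e2.
- have /triangulation_vertex_inj e2 : triangulation_vertex T1 = triangulation_vertex T'.
    by have : [set triangulation_vertex T1] (triangulation_vertex T1) by []; rewrite e1.
  by rewrite -e2.
Qed.

Lemma associahedron_graph_diameter D :
  graph_diameter (triangulation v) (flip_adj v) D ->
  graph_diameter (polytope_vertex P) (polytope_adj P) D.
Proof.
apply: (@graph_diameter_iso _ _ _ _ _ _ triangulation_vertex).
- by move=> T T' [].
- by move=> x y [].
- exact: triangulation_vertex_face.
- exact: triangulation_vertex_surj.
- exact: triangulation_vertex_inj.
- move=> T T' tT tT'; split; first exact: flip_polytope_adj.
  exact: polytope_adj_flip.
Qed.

End AssociahedronGraph.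

Theorem theorem13 (R : realType) :
  (forall (d m : nat) (P : set 'rV[R]_m),
     (9 < d)%N -> associahedron P d ->
     graph_diameter (polytope_vertex P) (polytope_adj P) (2 * d - 4)%N) /\
  (forall (n : nat) (v : 'I_n -> 'rV[R]_2),
     (12 < n)%N -> convex_polygon v ->
     graph_diameter (triangulation v) (flip_adj v) (2 * n - 10)%N).
Proof.
have diam n (v : 'I_n -> 'rV[R]_2) : (12 < n)%N -> convex_polygon v ->
    graph_diameter (triangulation v) (flip_adj v) (2 * n - 10)%N.
  by move=> n12 cv; have [s cs] := cyclic_order_ex cv; apply: (flip_graph_diameter cs).
split=> // d m P d9 [pP _ [v [phi [cv phi_face phi_surj phi_sub]]]].
apply: (associahedron_graph_diameter pP cv phi_face phi_surj phi_sub).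
have -> : (2 * d - 4 = 2 * (d + 3) - 10)%N by lia.
by apply: diam => //; lia.
Qed.
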